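(* Let $d,m\in\mathbb{N}$, and let $\boldsymbol{\gamma}:\mathbb{R}^d\to\mathbb{R}^{m\times m}$ be a pseudo cross-variogram. Let $f$ be an entire function taking real values on the reals. Assume that - $f(0)>0$ and $f'(0)=0$; - all the zeros of $f$ are purely imaginary; - the order $\rho$ of $f$ is less than $2$, i.e. $$\rho=\limsup_{r\to\infty}\frac{\log\log M(r)}{\log r}<2,\qquad M(r)=\max\{|f(z)|:|z|=r\}.$$ Then, for every $\nu\in[0,1]$, the function $\boldsymbol{C}:\mathbb{R}^d\to\mathbb{R}^{m\times m}$ defined by $$C_{ij}(\boldsymbol{h})=\frac{f\left(\nu\sqrt{\gamma_{ij}(\boldsymbol{h})}\right)}{f\left(\sqrt{\gamma_{ij}(\boldsymbol{h})}\right)},\qquad i,j=1,\dots,m,$$ is infinitely divisible.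
   Context: A function $\boldsymbol{C}:\mathbb{R}^d\to\mathbb{R}^{m\times m}$ is called positive definite if $C_{ij}(\boldsymbol{h})=C_{ji}(-\boldsymbol{h})$ for all $\boldsymbol{h},i,j$, and $\sum_{i,j=1}^n\boldsymbol{a}_i^\top\boldsymbol{C}(\boldsymbol{x}_i-\boldsymbol{x}_j)\boldsymbol{a}_j\ge0$ for all $n\in\mathbb{N}$, $\boldsymbol{x}_1,\dots,\boldsymbol{x}_n\in\mathbb{R}^d$, $\boldsymbol{a}_1,\dots,\boldsymbol{a}_n\in\mathbb{R}^m$. A positive definite $\boldsymbol{C}$ is infinitely divisible if for each $n\in\mathbb{N}$ there is a positive definite function $\boldsymbol{C}_n:\mathbb{R}^d\to\mathbb{R}^{m\times m}$ with $\boldsymbol{C}=\boldsymbol{C}_n^{\ast n}$, where $^{\ast n}$ denotes the componentwise $n$-th power; equivalently, the componentwise power $\boldsymbol{C}^{\ast r}$ is positive definite for all $r>0$. A pseudo cross-variogram on $\mathbb{R}^d$ is a function $\boldsymbol{\gamma}:\mathbb{R}^d\to\mathbb{R}^{m\times m}$ of the form $\gamma_{ij}(\boldsymbol{h})=\frac12\mathrm{Var}(Z_i(\boldsymbol{x}+\boldsymbol{h})-Z_j(\boldsymbol{x}))$, where $Z=(Z_1,\dots,Z_m)$ is a real $m$-variate random field on $\mathbb{R}^d$ such that all differences $Z_i(\boldsymbol{x})-Z_j(\boldsymbol{y})$ are square integrable and $\mathrm{Var}(Z_i(\boldsymbol{x}+\boldsymbol{h})-Z_j(\boldsymbol{x}))$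 does not depend on $\boldsymbol{x}$. Equivalently (known result): $\gamma_{ii}(\boldsymbol{0})=0$ for all $i$, $\gamma_{ij}(\boldsymbol{h})=\gamma_{ji}(-\boldsymbol{h})$, and $\sum_{i,j=1}^n\boldsymbol{a}_i^\top\boldsymbol{\gamma}(\boldsymbol{x}_i-\boldsymbol{x}_j)\boldsymbol{a}_j\le0$ for all $n$, $\boldsymbol{x}_i\in\mathbb{R}^d$, $\boldsymbol{a}_i\in\mathbb{R}^m$ such that the sum of all components of all $\boldsymbol{a}_i$ is zero. *)

(* Defs.v *)
From HB Require Import structures.
From mathcomp Require Import all_boot all_order all_algebra.
From mathcomp Require Import all_classical all_reals all_analysis.
From mathcomp Require Export complex.
Set Implicit Arguments.
Unset Strict Implicit.
Unset Printing Implicit Defensive.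
Import Order.TTheory GRing.Theory Num.Theory.
Import numFieldNormedType.Exports.

Local Open Scope classical_set_scope.
Local Open Scope complex_scope.
Local Open Scope ring_scope.

Definition positive_definite (R : realType) (d m : nat)
    (C : 'rV[R]_d -> 'M[R]_m) : Prop :=
  (forall h i j, C h i j = C (- h) j i) /\
  (forall (n : nat) (x : 'I_n -> 'rV[R]_d) (a : 'I_n -> 'cV[R]_m),
    0 <= \sum_(i < n) \sum_(j < n)
           ((a i)^T *m C (x i - x j) *m a j) ord0 ord0).

Definition infinitely_divisible (R : realType) (d m : nat)
    (C : 'rV[R]_d -> 'M[R]_m) : Prop :=
  positive_definite C /\
  (forall n : nat, (0 < n)%N ->
    exists Cn : 'rV[R]_d -> 'M[R]_m,
      positive_definite Cn /\
      forall h i j, C h i j = Cn h i j ^+ n).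

Definition pseudo_cross_variogram (R : realType) (d m : nat)
    (gamma : 'rV[R]_d -> 'M[R]_m) : Prop :=
  exists (disp : measure_display) (T : measurableType disp)
         (P : probability T R) (Z : 'I_m -> 'rV[R]_d -> {RV P >-> R}),
    (forall i j x y, (Z i x \- Z j y : T -> R) \in Lfun P 2%:E) /\
    (forall i j h x,
      (gamma h i j)%:E = ((2^-1)%:E * 'V_P[(Z i (x + h) \- Z j x)%R])%E).

(* The carrier R[i]^o makes R[i] a normed module over itself, so that
   derivability in the direction 1 is complex differentiability. *)
Definition entire (R : realType) (f : R[i] -> R[i]) : Prop :=
  forall z : R[i]^o, derivable (f : R[i]^o -> R[i]^o) z 1.

(* The norm of R[i] is R[i]-valued (with null imaginary part). *)
Definition max_modulus (R : realType) (f : R[i] -> R[i]) (r : R) : R :=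
  sup [set complex.Re `|f z| | z in [set z : R[i] | `|z| = r%:C]].

(* Since ln is null on nonpositive reals, a constant function has order 0;
   for a nonconstant entire function, both logarithms are eventually taken at
   positive reals. *)
Definition growth_order (R : realType) (f : R[i] -> R[i]) : \bar R :=
  limf_esup (fun r : R => (ln (ln (max_modulus f r)) / ln r)%:E) +oo%R.

(* Main.v *)
(** On a disk of radius r, write f = P F with P = prod (1 - z/a) over the zeros a
    of f in the disk and F zero-free there.  A logarithm G of F satisfies
    Re G <= O(r^tau) with tau < 2 (mean value inequality on circles on which
    |P| >= 1), so Borel-Caratheodory bounds G(z) - G(0) - G'(0) z by
    O(r^(tau-2)) on compact sets.  The zeros being imaginary and f'(0) = 0,
    Re G'(0) = 0 and |P(x)|^2 is a finite product of factors 1 + t x^2 with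
    t >= 0; hence ln (f(x)/f(0)) is a locally uniform limit of finite sums of
    (1/2) ln (1 + t x^2).

    On the kernel side, a pseudo cross-variogram is u_p + u_q - K_pq with K a
    covariance, so exp(-t gamma) is positive semidefinite for t >= 0.  For
    b >= 1,
      ln (b + s) - ln (1 + s)
        = lim_(e -> 0) sum_k (exp(-ek) - exp(-ekb)) / k * exp(-eks)
    is a limit of nonnegative combinations of the functions exp(-us), hence
    every power of (b + gamma)/(1 + gamma) is positive semidefinite, and so is
    every power of f(nu sqrt(gamma))/f(sqrt(gamma)). *)

Require Import Defs.
From HB Require Import structures.
From mathcomp Require Import all_boot all_order all_algebra.
From mathcomp Require Import all_classical all_reals all_analysis.
From mathcomp Require Import complex.
From mathcomp Require Import ring lra.
Import Order.TTheory GRing.Theory Num.Theory.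
Import numFieldNormedType.Exports.

Set Implicit Arguments.
Unset Strict Implicit.
Unset Printing Implicit Defensive.
Local Open Scope classical_set_scope.
Local Open Scope complex_scope.
Local Open Scope ring_scope.

(** * Complex norm and complex derivatives *)

Section ComplexNorm.
Variable R : realType.
Implicit Types z w : R[i].

(** No infinite product is formed and no convergence over the zeros is proved. Positive
    semidefiniteness concerns finitely many points, hence finitely many arguments sqrt(gamma) in
    some [0, X], and it passes to pointwise limits; so a finite product depending on the wanted
    precision is enough. Order below 2 enters here: once P is divided out, the part of the logarithm
    beyond its linear term vanishes on [0, X] as r grows, and f'(0) = 0 forces the linear
    coefficient to be the sum of the 1/a, which is imaginary and so invisible to the modulus on the
    real axis. The value f(0) cancels in the quotient. In the factors (1 + nu^2 t s) / (1 + t s)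
    that remain, t gamma has the same kernel properties as gamma, so one statement covers all t. The
    limit formula for ln (b + s) - ln (1 + s) is a Riemann sum of step e of the Frullani integral of
    (exp(-u) - exp(-ub)) / u * exp(-us) over u > 0; its sum over k is a difference of power series
    of ln (1 - w), so no improper integral occurs. Logarithms are kept to the end, since a k-th root
    then becomes a factor 1/k. *)

Definition nrm (z : R[i]) : R := Normc.normc z.

Lemma nrmE z : nrm z = Num.sqrt (complex.Re z ^+ 2 + complex.Im z ^+ 2).
Proof. by case: z. Qed.

Lemma nrm_ge0 z : 0 <= nrm z.
Proof. by rewrite nrmE sqrtr_ge0. Qed.

Lemma nrm_sqr z : nrm z ^+ 2 = complex.Re z ^+ 2 + complex.Im z ^+ 2.
Proof. by rewrite nrmE sqr_sqrtr // addr_ge0 ?sqr_ge0. Qed.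

Lemma nrm0 : nrm 0 = 0. Proof. exact: Normc.normc0. Qed.
Lemma nrm1 : nrm 1 = 1. Proof. exact: Normc.normc1. Qed.
Lemma nrmM z w : nrm (z * w) = nrm z * nrm w.
Proof. exact: Normc.normcM. Qed.
Lemma nrmV z : nrm z^-1 = (nrm z)^-1.
Proof. exact: Normc.normcV. Qed.
Lemma nrmN z : nrm (- z) = nrm z.
Proof. exact: normcN. Qed.
Lemma nrmD z w : nrm (z + w) <= nrm z + nrm w.
Proof. exact: le_normcD. Qed.
Lemma nrmBC z w : nrm (z - w) = nrm (w - z).
Proof. by rewrite -nrmN opprB. Qed.
Lemma nrmB z w : nrm (z - w) <= nrm z + nrm w.
Proof. by rewrite -[X in _ <= _ + X]nrmN nrmD. Qed.
Lemma nrmX z n : nrm (z ^+ n) = nrm z ^+ n.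
Proof. by elim: n => [|n IH]; rewrite ?nrm1 // !exprS nrmM IH. Qed.
Lemma nrm_real (x : R) : nrm x%:C = `|x|.
Proof. by rewrite nrmE /= expr0n addr0 sqrtr_sqr. Qed.
Lemma nrm_i : nrm 'i = 1.
Proof. by rewrite nrmE /= expr0n add0r expr1n sqrtr1. Qed.
Lemma nrm_eq0 z : (nrm z == 0) = (z == 0).
Proof.
by apply/eqP/eqP => [/Normc.eq0_normc//|->]; rewrite nrm0.
Qed.
Lemma nrm_gt0 z : (0 < nrm z) = (z != 0).
Proof. by rewrite lt_def nrm_ge0 andbT nrm_eq0. Qed.
Lemma Re_le_nrm z : `|complex.Re z| <= nrm z.
Proof.
rewrite -(@ler_pXn2r _ 2) ?nnegrE ?nrm_ge0 // nrm_sqr real_normK ?num_real //.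
by rewrite lerDl sqr_ge0.
Qed.
Lemma Im_le_nrm z : `|complex.Im z| <= nrm z.
Proof.
rewrite -(@ler_pXn2r _ 2) ?nnegrE ?nrm_ge0 // nrm_sqr real_normK ?num_real //.
by rewrite lerDr sqr_ge0.
Qed.
Lemma nrm_leD z : nrm z <= `|complex.Re z| + `|complex.Im z|.
Proof.
rewrite [z in nrm z]complexE; apply: (le_trans (nrmD _ _)).
by rewrite nrmM nrm_i mul1r !nrm_real.
Qed.
Lemma nrm_rev z w : nrm z - nrm w <= nrm (z - w).
Proof. by rewrite lerBlDr (le_trans _ (nrmD _ _)) // subrK. Qed.
Lemma normE z : `|z| = (nrm z)%:C.
Proof. by rewrite normc_def nrmE. Qed.
Lemma cRe_D z w : complex.Re (z + w) = complex.Re z + complex.Re w.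
Proof. by case: z w => ? ? []. Qed.
Lemma cIm_D z w : complex.Im (z + w) = complex.Im z + complex.Im w.
Proof. by case: z w => ? ? []. Qed.
Lemma cRe_N z : complex.Re (- z) = - complex.Re z.
Proof. by case: z. Qed.
Lemma cIm_N z : complex.Im (- z) = - complex.Im z.
Proof. by case: z. Qed.
Lemma cRe_M z w : complex.Re (z * w) =
  complex.Re z * complex.Re w - complex.Im z * complex.Im w.
Proof. by case: z w => ? ? []. Qed.
Lemma cIm_M z w : complex.Im (z * w) =
  complex.Re z * complex.Im w + complex.Im z * complex.Re w.
Proof. by case: z w => ? ? []. Qed.
Lemma c_eq z w : complex.Re z = complex.Re w -> complex.Im z = complex.Im w -> z = w.
Proof. by case: z w => ? ? [? ?] /= -> ->. Qed.
Definition cE := (cRe_D, cIm_D, cRe_N, cIm_N, cRe_M, cIm_M).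

End ComplexNorm.

Section TDiff.
Variables (R : realType) (T : Type) (i : T -> R[i]).
Local Notation C := R[i].
Implicit Types (f g : T -> C) (t s : T) (l m : C).
Local Notation nrm := (@nrm R).

(* [i] embeds the domain in the plane: [i = id] gives complex functions of a
   complex variable, [i = real_complex R] complex-valued curves. *)
Definition tcont f t := forall e : R, 0 < e ->
  exists2 d : R, 0 < d & forall s, nrm (i s - i t) < d -> nrm (f s - f t) <= e.

(** The division-free form of the derivative needs no puncturing at [t], so products and
    compositions reduce to norm estimates. *)
Definition tdiff f t l := forall e : R, 0 < e ->
  exists2 d : R, 0 < d & forall s, nrm (i s - i t) < d ->
    nrm (f s - f t - l * (i s - i t)) <= e * nrm (i s - i t).

Lemma tdiff_near f g t l : (exists2 d : R, 0 < d & forall s,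
    nrm (i s - i t) < d -> f s = g s) -> tdiff f t l -> tdiff g t l.
Proof.
move=> [d d0 fg] fl e e0; have [d' d'0 H] := fl e e0.
exists (Num.min d d'); first by rewrite lt_min d0.
move=> s; rewrite lt_min => /andP[s1 s2].
by rewrite -!fg ?H // subrr nrm0.
Qed.

Lemma tdiff_eq f g t l m : f =1 g -> l = m -> tdiff f t l -> tdiff g t m.
Proof. by move=> fg <-; apply: tdiff_near; exists 1. Qed.

Lemma tdiff_cst c t : tdiff (fun=> c) t 0.
Proof.
move=> e e0; exists 1 => // s _.
by rewrite subrr mul0r subrr nrm0 mulr_ge0 ?nrm_ge0 ?ltW.
Qed.

Lemma tdiff_id t : tdiff i t 1.
Proof.
move=> e e0; exists 1 => // s _.
by rewrite mul1r subrr nrm0 mulr_ge0 ?nrm_ge0 ?ltW.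
Qed.

Lemma tdiff_lip f t l : tdiff f t l -> exists2 d : R, 0 < d & forall s,
  nrm (i s - i t) < d -> nrm (f s - f t) <= (nrm l + 1) * nrm (i s - i t).
Proof.
move=> /(_ _ ltr01)[d d0 H]; exists d => // s /H H'.
rewrite -[f s - f t](subrK (l * (i s - i t))) (le_trans (nrmD _ _)) //.
by rewrite nrmM; lra.
Qed.

Lemma tdiff_tcont f t l : tdiff f t l -> tcont f t.
Proof.
move=> /tdiff_lip[d d0 H] e e0.
have l1 : 0 < nrm l + 1 by rewrite ltr_wpDl ?nrm_ge0.
exists (Num.min d (e / (nrm l + 1))); first by rewrite lt_min d0 divr_gt0.
move=> s; rewrite lt_min => /andP[/H s1 s2].
by rewrite (le_trans s1) // mulrC -ler_pdivlMr // ltW.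
Qed.

Lemma tdiffD f g t l m : tdiff f t l -> tdiff g t m ->
  tdiff (fun s => f s + g s) t (l + m).
Proof.
move=> fl gm e e0; have e20 : 0 < e / 2 by rewrite divr_gt0.
have [d d0 H] := fl _ e20; have [d' d'0 H'] := gm _ e20.
exists (Num.min d d'); first by rewrite lt_min d0.
move=> s; rewrite lt_min => /andP[/H s1 /H' s2].
have -> : f s + g s - (f t + g t) - (l + m) * (i s - i t) =
  (f s - f t - l * (i s - i t)) + (g s - g t - m * (i s - i t)) by ring.
rewrite (le_trans (nrmD _ _)) //; lra.
Qed.

Lemma tdiffM f g t l m : tdiff f t l -> tdiff g t m ->
  tdiff (fun s => f s * g s) t (l * g t + f t * m).
Proof.
move=> fl gm e e0.
have [df df0 Lf] := tdiff_lip fl; have [dg dg0 Lg] := tdiff_lip gm.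
set a := nrm (f t); set b := nrm (g t); set p := nrm l + 1; set q := nrm m + 1.
have a0 : 0 <= a := nrm_ge0 _. have b0 : 0 <= b := nrm_ge0 _.
have p0 : 0 < p by rewrite ltr_wpDl ?nrm_ge0.
have q0 : 0 < q by rewrite ltr_wpDl ?nrm_ge0.
pose e1 := e / (2 * (a + b + 1)).
have ab1 : 0 < 2 * (a + b + 1) by lra.
have e10 : 0 < e1 by rewrite divr_gt0.
have E1 : e1 * (2 * (a + b + 1)) = e by rewrite divfK ?gt_eqF.
have [d d0 H] := fl _ e10; have [d' d'0 H'] := gm _ e10.
pose d3 := e / (2 * (p * q)).
have pq0 : 0 < 2 * (p * q) by rewrite !mulr_gt0.
have d30 : 0 < d3 by rewrite divr_gt0.
have E3 : d3 * (2 * (p * q)) = e by rewrite divfK ?gt_eqF.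
exists (Num.min (Num.min df dg) (Num.min (Num.min d d') d3)).
  by rewrite !lt_min df0 dg0 d0 d'0.
move=> s; rewrite !lt_min => /andP[/andP[/Lf s1 /Lg s2] /andP[/andP[/H s3 /H' s4] s5]].
set D := i s - i t in s1 s2 s3 s4 s5 *.
have -> : f s * g s - f t * g t - (l * g t + f t * m) * D =
  (f s - f t - l * D) * g t + (f t * (g s - g t - m * D) + (f s - f t) * (g s - g t))
  by ring.
rewrite (le_trans (nrmD _ _)) // nrmM.
have := nrmD (f t * (g s - g t - m * D)) ((f s - f t) * (g s - g t)).
rewrite !nrmM -/a -/b => H1.
have D0 : 0 <= nrm D := nrm_ge0 _.
have h1 : nrm (f s - f t) * nrm (g s - g t) <= (p * nrm D) * (q * nrm D).
  by apply: ler_pM => //; apply: nrm_ge0.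
have h2 : (p * nrm D) * (q * nrm D) <= (e / 2) * nrm D.
  have -> : (p * nrm D) * (q * nrm D) = (nrm D * (p * q)) * nrm D by ring.
  rewrite ler_wpM2r // -E3; have -> : d3 * (2 * (p * q)) / 2 = d3 * (p * q) by field.
  by rewrite ler_wpM2r ?mulr_ge0 // ltW.
have h3 : nrm (f s - f t - l * D) * b <= e1 * nrm D * b by rewrite ler_wpM2r.
have h4 : a * nrm (g s - g t - m * D) <= a * (e1 * nrm D) by rewrite ler_wpM2l.
have h5 : 0 <= e1 * nrm D by rewrite mulr_ge0 // ltW.
have -> : e * nrm D = e1 * nrm D * b + a * (e1 * nrm D) + e1 * nrm D + e / 2 * nrm D.
  by rewrite -E1; field.
lra.
Qed.

Lemma tdiffZ c f t l : tdiff f t l -> tdiff (fun s => c * f s) t (c * l).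
Proof.
move=> fl; apply: tdiff_eq (tdiffM (tdiff_cst c t) fl) => //.
by rewrite mul0r add0r.
Qed.

Lemma tdiffN f t l : tdiff f t l -> tdiff (fun s => - f s) t (- l).
Proof.
by move=> fl; apply: tdiff_eq (tdiffZ (-1) fl) => [s|]; rewrite mulN1r.
Qed.

Lemma tdiffB f g t l m : tdiff f t l -> tdiff g t m ->
  tdiff (fun s => f s - g s) t (l - m).
Proof. by move=> fl gm; apply: tdiffD fl (tdiffN gm). Qed.

Lemma tcont_cst c t : tcont (fun=> c) t.
Proof. exact: tdiff_tcont (tdiff_cst c t). Qed.

Lemma tcontD f g t : tcont f t -> tcont g t -> tcont (fun s => f s + g s) t.
Proof.
move=> fl gm e e0; have e20 : 0 < e / 2 by rewrite divr_gt0.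
have [d d0 H] := fl _ e20; have [d' d'0 H'] := gm _ e20.
exists (Num.min d d'); first by rewrite lt_min d0.
move=> s; rewrite lt_min => /andP[/H s1 /H' s2].
have -> : f s + g s - (f t + g t) = (f s - f t) + (g s - g t) by ring.
rewrite (le_trans (nrmD _ _)) //; lra.
Qed.

Lemma tcontM f g t : tcont f t -> tcont g t -> tcont (fun s => f s * g s) t.
Proof.
move=> fl gm e e0.
set a := nrm (f t); set b := nrm (g t).
have a0 : 0 <= a := nrm_ge0 _. have b0 : 0 <= b := nrm_ge0 _.
have ab : 0 < a + b + 1 by lra.
pose e1 := Num.min 1 (e / (a + b + 1)).
have e10 : 0 < e1 by rewrite lt_min ltr01 divr_gt0.
have e11 : e1 <= 1 by rewrite ge_min lexx.
have e12 : e1 * (a + b + 1) <= e by rewrite -ler_pdivlMr // ge_min lexx orbT.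
have [d d0 H] := fl _ e10; have [d' d'0 H'] := gm _ e10.
exists (Num.min d d'); first by rewrite lt_min d0.
move=> s; rewrite lt_min => /andP[/H s1 /H' s2].
have -> : f s * g s - f t * g t =
  (f s - f t) * g t + (f t * (g s - g t) + (f s - f t) * (g s - g t)) by ring.
rewrite (le_trans (nrmD _ _)) // nrmM.
have := nrmD (f t * (g s - g t)) ((f s - f t) * (g s - g t)).
rewrite !nrmM -/a -/b => H1.
have h1 : nrm (f s - f t) * nrm (g s - g t) <= e1 * 1.
  by apply: ler_pM; rewrite ?nrm_ge0 // (le_trans s2).
have h3 : nrm (f s - f t) * b <= e1 * b by rewrite ler_wpM2r.
have h4 : a * nrm (g s - g t) <= a * e1 by rewrite ler_wpM2l.
rewrite (le_trans _ e12) //; have -> : e1 * (a + b + 1) = e1 * b + a * e1 + e1 * 1 by ring.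
lra.
Qed.

Lemma tcontN f t : tcont f t -> tcont (fun s => - f s) t.
Proof.
move=> fl e e0; have [d d0 H] := fl _ e0; exists d => // s /H.
by rewrite -opprD nrmN.
Qed.

Lemma tcontB f g t : tcont f t -> tcont g t -> tcont (fun s => f s - g s) t.
Proof. by move=> ? ?; apply: tcontD => //; apply: tcontN. Qed.

Lemma tcont_near f g t : (exists2 d : R, 0 < d & forall s,
    nrm (i s - i t) < d -> f s = g s) -> tcont f t -> tcont g t.
Proof.
move=> [d d0 fg] fl e e0; have [d' d'0 H] := fl e e0.
exists (Num.min d d'); first by rewrite lt_min d0.
move=> s; rewrite lt_min => /andP[s1 s2].
by rewrite -!fg ?H // subrr nrm0.
Qed.

End TDiff.

Section CDiff.
Variable (R : realType).
Local Notation C := R[i].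
Local Notation nrm := (@nrm R).

Definition cdiff (f : C -> C) := tdiff (@id C) f.
Definition ccont (f : C -> C) := tcont (@id C) f.
Definition rdiff (f : R -> C) := tdiff (real_complex R) f.
Definition rcont (f : R -> C) := tcont (real_complex R) f.

Lemma tcont_comp T (i : T -> C) (f : C -> C) (g : T -> C) t :
  ccont f (g t) -> tcont i g t -> tcont i (fun s => f (g s)) t.
Proof.
move=> fc gc e e0; have [d d0 H] := fc e e0.
have d20 : 0 < d / 2 by rewrite divr_gt0.
have [d' d'0 H'] := gc _ d20; exists d' => // s /H' H2.
apply: H; rewrite (le_lt_trans H2) //; lra.
Qed.

Lemma tdiff_comp T (i : T -> C) (f : C -> C) (g : T -> C) t l m :
  cdiff f (g t) l -> tdiff i g t m -> tdiff i (fun s => f (g s)) t (l * m).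
Proof.
move=> fl gm e e0; have [dg dg0 Lg] := tdiff_lip gm.
set q := nrm m + 1; set p := nrm l + 1.
have p0 : 0 < p by rewrite ltr_wpDl ?nrm_ge0.
have q0 : 0 < q by rewrite ltr_wpDl ?nrm_ge0.
have e10 : 0 < e / (2 * q) by rewrite divr_gt0 // mulr_gt0.
have e20 : 0 < e / (2 * p) by rewrite divr_gt0 // mulr_gt0.
have [d d0 H] := fl _ e10; have [d' d'0 H'] := gm _ e20.
exists (Num.min (Num.min dg d') (d / q)); first by rewrite !lt_min dg0 d'0 divr_gt0.
move=> s; rewrite !lt_min => /andP[/andP[/Lg s1 /H' s2] s3].
set D := i s - i t in s1 s2 s3 *.
have D0 : 0 <= nrm D := nrm_ge0 _.
have s4 : nrm (g s - g t) < d.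
  by rewrite (le_lt_trans s1) // mulrC -ltr_pdivlMr.
have {}H := H _ s4.
have -> : f (g s) - f (g t) - l * m * D =
  (f (g s) - f (g t) - l * (g s - g t)) + l * (g s - g t - m * D) by ring.
rewrite (le_trans (nrmD _ _)) // nrmM.
have h1 : e / (2 * q) * nrm (g s - g t) <= e / (2 * q) * (q * nrm D).
  by rewrite ler_wpM2l // ltW.
have h2 : nrm l * nrm (g s - g t - m * D) <= p * (e / (2 * p) * nrm D).
  by rewrite ler_pM ?nrm_ge0 // /p lerDl.
have -> : e * nrm D = e / (2 * q) * (q * nrm D) + p * (e / (2 * p) * nrm D).
  by field; rewrite !gt_eqF.
lra.
Qed.

Lemma ccontV z : z != 0 -> ccont (fun w => w^-1) z.
Proof.
move=> z0 e e0; have a0 : 0 < nrm z by rewrite nrm_gt0.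
exists (Num.min (nrm z / 2) (e * (nrm z / 2) * nrm z)).
  by rewrite lt_min !mulr_gt0 ?invr_gt0.
move=> w; rewrite lt_min /= => /andP[w1 w2].
have w3 : nrm z / 2 <= nrm w.
  by have := nrm_rev z w; rewrite nrmBC; lra.
have w0 : w != 0 by rewrite -nrm_gt0; lra.
have -> : w^-1 - z^-1 = - (w - z) / (w * z) by field; rewrite z0.
rewrite nrmM nrmN nrmV nrmM ler_pdivrMr ?mulr_gt0 ?nrm_gt0 //.
by rewrite (le_trans (ltW w2)) // -[e * _ * _]mulrA ler_wpM2l ?(ltW e0) // ler_wpM2r ?nrm_ge0.
Qed.

Lemma cdiffV z : z != 0 -> cdiff (fun w => w^-1) z (- z ^- 2).
Proof.
move=> z0 e e0; have a0 : 0 < nrm z by rewrite nrm_gt0.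
have [d d0 H] := ccontV z0 (mulr_gt0 e0 a0).
exists (Num.min (nrm z / 2) d); first by rewrite lt_min d0 divr_gt0.
move=> w; rewrite lt_min /= => /andP[w1 /H w2].
have w3 : nrm z / 2 <= nrm w.
  by have := nrm_rev z w; rewrite nrmBC; lra.
have w0 : w != 0 by rewrite -nrm_gt0; lra.
have -> : w^-1 - z^-1 - - z ^- 2 * (w - z) = - (w^-1 - z^-1) / z * (w - z).
  by field; rewrite z0.
by rewrite /= nrmM nrmM nrmN nrmV ler_wpM2r ?nrm_ge0 // ler_pdivrMr.
Qed.

Lemma tdiffV T (i : T -> C) (f : T -> C) t l : f t != 0 -> tdiff i f t l ->
  tdiff i (fun s => (f s)^-1) t (- (f t) ^- 2 * l).
Proof. by move=> ft0 fl; apply: (tdiff_comp _ fl); apply: cdiffV. Qed.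

Lemma tcontV T (i : T -> C) (f : T -> C) t : f t != 0 -> tcont i f t ->
  tcont i (fun s => (f s)^-1) t.
Proof. by move=> ft0 fl; apply: (tcont_comp _ fl); apply: ccontV. Qed.

End CDiff.

(** * Primitives of continuous curves *)

Section Bridge.

(** Stated over any [numFieldType] so that the same equivalence serves real functions and, with an
    [R[i]]-valued norm, complex ones. *)
Lemma is_derive_epsP (K : numFieldType) (f : K^o -> K^o) (z l : K) :
  is_derive (z : K^o) 1 f l <-> forall e : K, 0 < e -> exists2 d : K, 0 < d &
    forall w, `|w - z| < d -> `|f w - f z - l * (w - z)| <= e * `|w - z|.
Proof.
have E (h w : K) : h != 0 -> w = z + h ->
    `|h^-1 *: (f (h *: 1 + z) - f z) - l| * `|w - z| = `|f w - f z - l * (w - z)|.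
  move=> h0 ->; have -> : z + h - z = h by rewrite addrC addrA addNr add0r.
  rewrite -normrM mulrBl; congr (`| _ - _|).
  rewrite [h *: 1]mulr1 [h + z]addrC [h^-1 *: _]mulrC mulfVK //.
split.
  move=> [dfl Dl] e e0; move: dfl; rewrite /derivable /= => dfl.
  have {}dfl : (h^-1 *: (f (h *: 1 + z) - f z) @[h --> 0^'] --> (l : K^o)).
    by rewrite -Dl; exact: dfl.
  move/cvgrPdist_le/(_ _ e0): dfl.
  move=> /nbhs_ballP[d /= d0 H].
  exists d => // w wd; have [->|wz] := eqVneq w z.
    by rewrite !subrr mulr0 normr0 subrr normr0 mulr0.
  have h0 : w - z != 0 by rewrite subr_eq0.
  have -> := esym (E _ w h0 _); last by rewrite addrC subrK.
  rewrite ler_wpM2r // -[X in X <= _]normrN opprB; apply: (H (w - z)) => //.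
  by rewrite -ball_normE /ball_ /= sub0r normrN.
move=> H.
have cl : (h^-1 *: (f (h *: 1 + z) - f z) @[h --> 0^'] --> (l : K^o)).
  apply/cvgrPdist_le => e e0; have [d d0 {}H] := H e e0.
  apply/nbhs_ballP; exists d => //= h.
  rewrite -ball_normE /ball_ /= sub0r normrN => hd h0.
  have hz : z + h - z = h by rewrite addrC addrA addNr add0r.
  have h0' : 0 < `|z + h - z| by rewrite hz normr_gt0.
  rewrite -[X in X <= _]normrN opprB -(ler_pM2r h0') (E _ (z + h)) //.
  by apply: H; rewrite hz.
split; first by apply/cvg_ex; exists l; exact: cl.
exact: cvg_lim cl.
Qed.

Variable R : realType.
Local Notation nrm := (@nrm R).

Lemma cdiff_is_derive (f : R[i] -> R[i]) z l :
  is_derive (z : R[i]^o) 1 (f : R[i]^o -> R[i]^o) l -> cdiff f z l.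
Proof.
move/is_derive_epsP => H e e0.
have [|d d0 {}H] := H e%:C; first by rewrite ltcR.
(* Positivity in [R[i]] includes a null imaginary part, so the radius is a real number. *)
have [d1 Ed] : exists d1 : R, d = d1%:C.
  by case: (d) d0 => a b; rewrite ltcE /= => /andP[/eqP -> _]; exists a.
exists d1; first by rewrite -ltcR -Ed.
move=> w wd; have := H w; rewrite !normE Ed ltcR -rmorphM lecR; exact.
Qed.

Lemma entire_cdiff (f : R[i] -> R[i]) (z : R[i]) :
  derivable (f : R[i]^o -> R[i]^o) (z : R[i]^o) 1 -> exists l, cdiff f z l.
Proof. by move=> /derivableP/cdiff_is_derive; eexists; eauto. Qed.

Lemma rdiff_Re (g : R -> R[i]) x l : rdiff g x l ->
  is_derive x 1 (fun y => complex.Re (g y)) (complex.Re l).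
Proof.
move=> gl; apply/is_derive_epsP => e /gl[d d0 H]; exists d => // y.
have Er (u v : R) : u%:C - v%:C = (u - v)%:C by rewrite rmorphB.
have := H y; rewrite Er nrm_real => {}H /H; apply: le_trans.
by apply: le_trans (Re_le_nrm _); rewrite !cE /= mulr0 subr0.
Qed.

Lemma rdiff_real (u : R -> R) (x l : R) : is_derive x 1 u l ->
  rdiff (fun y => (u y)%:C) x l%:C.
Proof.
move=> /is_derive_epsP ul e /ul[d d0 H]; exists d => // y.
have Er (a b : R) : a%:C - b%:C = (a - b)%:C by rewrite rmorphB.
by have := H y; rewrite !Er -rmorphM Er !nrm_real => {}H /H.
Qed.

Lemma rdiff_id (x : R) : rdiff (real_complex R) x 1.
Proof. exact: tdiff_id. Qed.

Lemma rcont_Re (g : R -> R[i]) x : rcont g x ->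
  {for x, continuous (fun y => complex.Re (g y))}.
Proof.
move=> gc; apply/cvgrPdist_le => e /gc[d d0 H].
apply/nbhs_ballP; exists d => //= y yd; rewrite /ball/= in yd.
have Er (a b : R) : a%:C - b%:C = (a - b)%:C by rewrite rmorphB.
rewrite (le_trans _ (H y _)) //.
  by rewrite -nrmN opprB (le_trans _ (Re_le_nrm _)) // !cE.
by rewrite Er nrm_real distrC.
Qed.

Lemma rcont_Im (g : R -> R[i]) x : rcont g x ->
  {for x, continuous (fun y => complex.Im (g y))}.
Proof.
move=> gc; apply/cvgrPdist_le => e /gc[d d0 H].
apply/nbhs_ballP; exists d => //= y yd; rewrite /ball/= in yd.
have Er (a b : R) : a%:C - b%:C = (a - b)%:C by rewrite rmorphB.
rewrite (le_trans _ (H y _)) //.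
  by rewrite -nrmN opprB (le_trans _ (Im_le_nrm _)) // !cE.
by rewrite Er nrm_real distrC.
Qed.

End Bridge.

Section MeanValue.
Variable R : realType.
Local Notation nrm := (@nrm R).

(** Multiplying an increment by such a [c] turns its modulus into a real part; the mean value
    inequality for curves then follows from the real mean value theorem. *)
Lemma nrm_rotate (w : R[i]) : exists2 c, nrm c <= 1 & complex.Re (c * w) = nrm w.
Proof.
have [->|w0] := eqVneq w 0; first by exists 0; rewrite ?mulr0 ?nrm0 //=.
have n0 : 0 < nrm w by rewrite nrm_gt0.
exists ((nrm w)^-1%:C * w^*).
  rewrite nrmM nrm_real ger0_norm ?invr_ge0 ?nrm_ge0 //.
  have -> : nrm w^* = nrm w by case: (w) => a b; rewrite !nrmE /= sqrrN.
  by rewrite mulVf ?gt_eqF.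
rewrite -mulrA; have -> : w^* * w = (nrm w ^+ 2)%:C.
  by rewrite nrm_sqr; case: (w) => a b; apply: c_eq; rewrite !cE /=; ring.
by rewrite -rmorphM /= expr2 mulKf ?gt_eqF.
Qed.

Lemma rdiff_bound (G g : R -> R[i]) (a b M : R) : a <= b ->
  (forall x, a <= x <= b -> rdiff G x (g x)) ->
  (forall x, a <= x <= b -> nrm (g x) <= M) -> nrm (G b - G a) <= M * (b - a).
Proof.
rewrite le_eqVlt => /predU1P[<- _ _|ab Gg gM]; first by rewrite !subrr nrm0 mulr0.
have [c c1 <-] := nrm_rotate (G b - G a).
have dc x : a <= x <= b ->
    is_derive x 1 (fun y => complex.Re (c * G y)) (complex.Re (c * g x)).
  by move=> xab; apply: rdiff_Re; apply: tdiffZ; apply: Gg.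
have [||x xab] := MVT ab (f := fun y => complex.Re (c * G y))
   (df := fun x => complex.Re (c * g x)).
- by move=> x; rewrite in_itv /= => /andP[xa xb]; apply: dc; rewrite !ltW.
- by apply: derivable_within_continuous => x; rewrite in_itv /= => /dc[].
rewrite (mulrBr c (G b)) cRe_D cRe_N => ->; rewrite ler_wpM2r ?subr_ge0 ?(ltW ab) //.
rewrite (le_trans (ler_norm _)) // (le_trans (Re_le_nrm _)) // nrmM.
move: xab; rewrite in_itv /= => /andP[xa xb].
rewrite (le_trans _ (gM x _)) ?(ltW xa) ?(ltW xb) //.
by rewrite ler_piMl ?nrm_ge0.
Qed.

Lemma rdiff0_cst (G : R -> R[i]) (a b : R) : a <= b ->
  (forall x, a <= x <= b -> rdiff G x 0) -> G b = G a.
Proof.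
move=> ab G0; apply/eqP; rewrite -subr_eq0 -nrm_eq0 eq_le nrm_ge0 andbT.
rewrite (le_trans (rdiff_bound ab G0 (M := 0) _)) ?mul0r // => x _.
by rewrite nrm0.
Qed.

Lemma real_prim_half (u : R -> R) (a : R) : continuous u ->
  exists U : R -> R, forall x : R, a < x -> is_derive x 1 U (u x).
Proof.
move=> uc.
exists (fun x => \int[lebesgue_measure]_(t in [set` `[a, x]]) u t)%R => x ax.
have [||||dU] := @continuous_FTC1_closed R u a x (x + 1).
- by rewrite ltrDl.
- apply: continuous_compact_integrable; first exact: segment_compact.
  by apply: continuous_subspaceT => y; exact: uc.
- by [].
- exact: uc.
by rewrite derive1E => <-; exact/derivableP.
Qed.

(** Integration from [-n] gives a primitive to the right of [-n] only. Normalised to vanish at 0,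
    these primitives agree on common domains, because their differences have null derivative, and so
    they glue. *)
Lemma real_prim (u : R -> R) : continuous u ->
  exists U : R -> R, forall x : R, is_derive x 1 U (u x).
Proof.
move=> uc.
have /choice[V HV] : forall n : nat, exists U : R -> R, forall x : R,
  - n%:R < x -> is_derive x 1 U (u x) by move=> n; exact: real_prim_half.
have cst n m x : - n%:R < x -> - n%:R < 0 :> R -> - m%:R < x -> - m%:R < 0 :> R ->
    V n x - V n 0 = V m x - V m 0.
  move=> nx n0 mx m0.
  have D y : - n%:R < y -> - m%:R < y -> rdiff (fun x => (V n x - V m x)%:C) y 0.
    move=> ny my; apply: rdiff_real.
    by apply: is_derive_eq (is_deriveB (HV n y ny) (HV m y my)) _; rewrite subrr.
  have [x0|x0] := leP 0 x.
    have := rdiff0_cst x0 (G := fun x => (V n x - V m x)%:C).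
    move=> /(_ _)/complexI H.
    have : V n x - V m x = V n 0 - V m 0.
      by apply: H => y /andP[y0 _]; apply: D; rewrite (lt_le_trans _ y0).
    lra.
  have := rdiff0_cst (ltW x0) (G := fun x => (V n x - V m x)%:C).
  move=> /(_ _)/complexI H.
  have : V n 0 - V m 0 = V n x - V m x.
    by apply: H => y /andP[y0 _]; apply: D; rewrite (lt_le_trans _ y0).
  lra.
(* The second successor leaves a margin of 1: every [y] at distance less than 1 from [x] is still to
   the right of [- k x]. *)
pose k (x : R) := (Num.truncn `|x|).+2.
have kx x : `|x| + 1 < (k x)%:R.
  by rewrite /k -addn1 natrD ltrD2r truncnS_gt.
exists (fun x => V (k x) x - V (k x) 0) => x.
apply/is_derive_epsP => e e0.
have xk : - (k x)%:R < x.
  have := kx x; have := ler_norm (- x); rewrite normrN; lra.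
have k0 z : - (k z)%:R < 0 :> R by rewrite oppr_lt0 ltr0n.
have /is_derive_epsP/(_ e e0)[d d0 H] := HV (k x) x xk.
exists (Num.min d 1); first by rewrite lt_min d0 ltr01.
move=> y; rewrite lt_min => /andP[yd y1].
have yk : - (k x)%:R < y.
  have := kx x; have := ler_norm (- x); have := ler_norm (-(y - x)).
  rewrite !normrN; lra.
have yk' : - (k y)%:R < y.
  have := kx y; have := ler_norm (- y); rewrite normrN; lra.
rewrite (cst (k y) (k x)) //.
have -> : V (k x) y - V (k x) 0 - (V (k x) x - V (k x) 0) = V (k x) y - V (k x) x by ring.
exact: H.
Qed.

Lemma prim_exists (g : R -> R[i]) : (forall x, rcont g x) ->
  exists G : R -> R[i], forall x, rdiff G x (g x).
Proof.
move=> gc.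
have [U HU] := real_prim (fun x => rcont_Re (gc x)).
have [V HV] := real_prim (fun x => rcont_Im (gc x)).
exists (fun x => (U x)%:C + 'i * (V x)%:C) => x.
apply: tdiff_eq (tdiffD (rdiff_real (HU x)) (tdiffZ 'i (rdiff_real (HV x)))) => //.
by rewrite -complexE.
Qed.

Definition prim (g : R -> R[i]) : R -> R[i] :=
  xget (fun=> 0) [set G | forall x, rdiff G x (g x)].

Lemma primP (g : R -> R[i]) : (forall x, rcont g x) ->
  forall x, rdiff (prim g) x (g x).
Proof.
move=> /prim_exists[G HG]; rewrite /prim.
by case: xgetP => [G' _ //|/(_ G)]; case.
Qed.

(** An integral taken as the increment of a chosen primitive: additivity and change of orientation
    are pure algebra. The default primitive 0 is irrelevant for the continuous integrands
    considered. *)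
Definition cint (a b : R) (g : R -> R[i]) := prim g b - prim g a.

Lemma cint_prim (a b : R) (g G : R -> R[i]) : (forall x, rcont g x) ->
  (forall x, Num.min a b <= x <= Num.max a b -> rdiff G x (g x)) ->
  cint a b g = G b - G a.
Proof.
move=> gc HG.
have D x : Num.min a b <= x <= Num.max a b -> rdiff (fun x => prim g x - G x) x 0.
  by move=> x01; apply: tdiff_eq (tdiffB (primP gc x) (HG x x01)); rewrite ?subrr.
have : prim g b - G b = prim g a - G a.
  have [ab|ab] := leP a b; move: D; rewrite ?(min_l ab) ?(max_r ab).
    by move=> D; exact: (rdiff0_cst ab D).
  rewrite (min_r (ltW ab)) (max_l (ltW ab)) => D.
  by rewrite (rdiff0_cst (ltW ab) D).
rewrite /cint => /eqP; rewrite subr_eq => /eqP ->; ring.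
Qed.

Lemma cint_split (a b c : R) g : cint a b g + cint b c g = cint a c g.
Proof. by rewrite /cint; ring. Qed.

Lemma cint_bound (a b M : R) g : (forall x, rcont g x) ->
  (forall x, Num.min a b <= x <= Num.max a b -> nrm (g x) <= M) ->
  nrm (cint a b g) <= M * `|b - a|.
Proof.
move=> gc gM; have [ab|ab] := leP a b; move: gM; rewrite ?(min_l ab) ?(max_r ab).
  move=> gM; rewrite ger0_norm ?subr_ge0 //.
  by apply: (@rdiff_bound (prim g) g) => // x _; exact: primP.
rewrite (min_r (ltW ab)) (max_l (ltW ab)) => gM.
rewrite distrC ger0_norm ?subr_ge0 ?(ltW ab) // /cint nrmBC.
by apply: (@rdiff_bound (prim g) g) => //; [exact: ltW|move=> x _; exact: primP].
Qed.

Lemma cintD (a b : R) g h : (forall x, rcont g x) -> (forall x, rcont h x) ->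
  cint a b (fun x => g x + h x) = cint a b g + cint a b h.
Proof.
move=> gc hc; rewrite (@cint_prim _ _ _ (fun x => prim g x + prim h x)).
- by rewrite /cint; ring.
- by move=> x; exact: (tcontD (gc x) (hc x)).
- by move=> x _; exact: tdiffD (primP gc x) (primP hc x).
Qed.

Lemma cintZ (a b : R) c g : (forall x, rcont g x) ->
  cint a b (fun x => c * g x) = c * cint a b g.
Proof.
move=> gc; rewrite (@cint_prim _ _ _ (fun x => c * prim g x)).
- by rewrite /cint; ring.
- by move=> x; exact: (tcontM (tcont_cst _ c x) (gc x)).
- by move=> x _; exact: tdiffZ (primP gc x).
Qed.

Lemma cint_cst (a b : R) c : cint a b (fun=> c) = c * (b - a)%:C.
Proof.
rewrite (@cint_prim _ _ _ (fun x => c * x%:C)).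
- by rewrite -mulrBr rmorphB.
- by move=> x; exact: tcont_cst.
- by move=> x _; apply: tdiff_eq (tdiffZ c (rdiff_id x)) => //; rewrite mulr1.
Qed.

End MeanValue.

(** * Goursat's theorem *)

Section Goursat.
Variable R : realType.
Local Notation nrm := (@nrm R).
Implicit Types (h : R[i] -> R[i]) (x y : R).

Lemma half_step (a b k w : R) : b = a \/ b = a + k / 2 * w -> 0 <= k * w ->
  a <= b /\ b + k / 2 * w <= a + k * w.
Proof. by case=> -> ?; split; lra. Qed.

(* [B x y k] reads "the rectangle with lower left corner [(x, y)] and sides [k * w]
   and [k * v] is bad"; a bad rectangle always has a bad quarter. *)
Lemma rect_bisect (B : R -> R -> R -> Prop) (x0 y0 w v : R) : 0 <= w -> 0 <= v ->
  (forall x y k, 0 < k -> B x y k ->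
    exists2 p : R * R, (p.1 = x \/ p.1 = x + k / 2 * w) /\
                       (p.2 = y \/ p.2 = y + k / 2 * v) & B p.1 p.2 (k / 2)) ->
  (forall cx cy, x0 <= cx <= x0 + w -> y0 <= cy <= y0 + v ->
    exists2 d, 0 < d & forall x y k, 0 < k < d ->
     x0 <= x -> x <= cx <= x + k * w -> x + k * w <= x0 + w ->
     y0 <= y -> y <= cy <= y + k * v -> y + k * v <= y0 + v -> ~ B x y k) ->
  ~ B x0 y0 1.
Proof.
move=> w0 v0 Hs Hl B0.
have /choice[F HF] : forall q : R * R * R, exists p : R * R,
    0 < q.2 -> B q.1.1 q.1.2 q.2 ->
    [/\ p.1 = q.1.1 \/ p.1 = q.1.1 + q.2 / 2 * w,
        p.2 = q.1.2 \/ p.2 = q.1.2 + q.2 / 2 * v & B p.1 p.2 (q.2 / 2)].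
  move=> [[x y] k]; have [kB|nkB] := pselect (0 < k /\ B x y k).
    by have [p [p1 p2] Bp] := Hs x y k kB.1 kB.2; exists p.
  by exists 0 => k0 Bk; exfalso; apply: nkB.
pose q := fix q n : R * R * R := if n is n'.+1 then (F (q n'), (q n').2 / 2) else (x0, y0, 1).
have q0 n : 0 < (q n).2 by elim: n => //= n IH; rewrite divr_gt0.
have qB n : B (q n).1.1 (q n).1.2 (q n).2.
  by elim: n => //= n IH; case: (HF (q n) (q0 n) IH).
have qS n : [/\ (q n).1.1 <= (q n.+1).1.1,
     (q n.+1).1.1 + (q n.+1).2 * w <= (q n).1.1 + (q n).2 * w,
     (q n).1.2 <= (q n.+1).1.2 &
     (q n.+1).1.2 + (q n.+1).2 * v <= (q n).1.2 + (q n).2 * v].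
  have /= [h1 h2 _] := HF (q n) (q0 n) (qB n).
  have kw : 0 <= (q n).2 * w by rewrite mulr_ge0 // ltW.
  have kv : 0 <= (q n).2 * v by rewrite mulr_ge0 // ltW.
  by have [? ?] := half_step h1 kw; have [? ?] := half_step h2 kv; split.
have mono m n : (m <= n)%N -> [/\ (q m).1.1 <= (q n).1.1,
     (q n).1.1 + (q n).2 * w <= (q m).1.1 + (q m).2 * w,
     (q m).1.2 <= (q n).1.2 &
     (q n).1.2 + (q n).2 * v <= (q m).1.2 + (q m).2 * v].
  move=> /subnK <-; elim: (n - m)%N => [|j [a b c d]]; first by split.
  have [a' b' c' d'] := qS (j + m)%N; rewrite addSn.
  by split; [exact: le_trans a'|exact: le_trans b|exact: le_trans c'|exact: le_trans d].
have kw n : 0 <= (q n).2 * w by rewrite mulr_ge0 // ltW.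
have kv n : 0 <= (q n).2 * v by rewrite mulr_ge0 // ltW.
have cross m n : (q m).1.1 <= (q n).1.1 + (q n).2 * w /\
                 (q m).1.2 <= (q n).1.2 + (q n).2 * v.
  have [a b c d] := mono _ _ (leq_maxl m n); have [a' b' c' d'] := mono _ _ (leq_maxr m n).
  have := kw (maxn m n); have := kv (maxn m n); split; lra.
(* Nested intervals: every lower end is below every upper end, so the supremum of the lower ends
   lies in all of them. *)
have lim (X : nat -> R) (Y : nat -> R) : (forall m n, X m <= Y n) ->
    exists c, forall n, X n <= c <= Y n.
  move=> XY; have hs : has_sup (range X).
    by split; [exists (X 0), 0|exists (Y 0) => _ [m _ <-]].
  exists (sup (range X)) => n; apply/andP; split.
    by apply: ub_le_sup; [case: hs|exists n].
  by apply: sup_le_ub; [case: hs|move=> _ [m _ <-]].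
have [cx Hx] := lim _ _ (fun m n => (cross m n).1).
have [cy Hy] := lim _ _ (fun m n => (cross m n).2).
have [||d d0 Hd] := Hl cx cy.
- by have := Hx 0; rewrite /= mul1r.
- by have := Hy 0; rewrite /= mul1r.
have qn n : (q n).2 = 2 ^- n.
  by elim: n => [|n IH] /=; rewrite ?invr1 ?expr0 ?invr1 // IH exprSr invfM.
pose n := (Num.truncn d^-1).+1.
have nd : (q n).2 < d.
  rewrite qn invf_plt ?posrE ?exprn_gt0 // (lt_le_trans (truncnS_gt _)) //.
  by rewrite -natrX ler_nat ltnW // ltn_expl.
have [a b c e] := mono _ _ (leq0n n); move: a b c e; rewrite /= !mul1r => a b c e.
by apply: (Hd (q n).1.1 (q n).1.2 (q n).2); rewrite ?q0 ?nd.
Qed.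

Definition hseg h y a b := cint a b (fun x => h (x +i* y)).
Definition vseg h x a b := cint a b (fun y => h (x +i* y)).
(** The contour integral along the boundary, counterclockwise when [x0 <= x1] and [y0 <= y1].
    Corners in another order only change the sign, so that any two points can serve as opposite
    corners. *)
Definition rint h x0 x1 y0 y1 :=
  hseg h y0 x0 x1 + 'i * vseg h x1 y0 y1 - hseg h y1 x0 x1 - 'i * vseg h x0 y0 y1.

Lemma rint_splitx h x0 x x1 y0 y1 :
  rint h x0 x1 y0 y1 = rint h x0 x y0 y1 + rint h x x1 y0 y1.
Proof. by rewrite /rint /hseg /cint; ring. Qed.

Lemma rint_splity h x0 x1 y0 y y1 :
  rint h x0 x1 y0 y1 = rint h x0 x1 y0 y + rint h x0 x1 y y1.
Proof. by rewrite /rint /vseg /cint; ring. Qed.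

Lemma rint_swapx h x0 x1 y0 y1 : rint h x1 x0 y0 y1 = - rint h x0 x1 y0 y1.
Proof. by rewrite /rint /hseg /cint; ring. Qed.

Lemma rint_swapy h x0 x1 y0 y1 : rint h x0 x1 y1 y0 = - rint h x0 x1 y0 y1.
Proof. by rewrite /rint /vseg /cint; ring. Qed.

Lemma complexE2 x y : x +i* y = x%:C + 'i * y%:C :> R[i].
Proof. by apply: c_eq; rewrite !cE /=; ring. Qed.

Lemma rdiff_hor y x : rdiff (fun t => t +i* y) x 1.
Proof.
apply: tdiff_eq (tdiffD (rdiff_id x) (tdiff_cst _ ('i * y%:C) x)) => [t|].
  by rewrite complexE2.
by rewrite addr0.
Qed.

Lemma rdiff_ver x y : rdiff (fun t => x +i* t) y 'i.
Proof.
apply: tdiff_eq (tdiffD (tdiff_cst _ x%:C y) (tdiffZ 'i (rdiff_id y))) => [t|].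
  by rewrite complexE2.
by rewrite add0r mulr1.
Qed.

Lemma rcont_hor h y x : (forall z, ccont h z) -> rcont (fun t => h (t +i* y)) x.
Proof. by move=> hc; apply: tcont_comp (hc _) (tdiff_tcont (rdiff_hor y x)). Qed.

Lemma rcont_ver h x y : (forall z, ccont h z) -> rcont (fun t => h (x +i* t)) y.
Proof. by move=> hc; apply: tcont_comp (hc _) (tdiff_tcont (rdiff_ver x y)). Qed.

Lemma rint_prim h P x0 x1 y0 y1 : (forall z, ccont h z) ->
  (forall z, cdiff P z (h z)) -> rint h x0 x1 y0 y1 = 0.
Proof.
move=> hc hP.
have Eh y a b : hseg h y a b = P (b +i* y) - P (a +i* y).
  rewrite /hseg; apply: (cint_prim (G := fun x => P (x +i* y))) => x *.
    exact: rcont_hor.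
  by apply: tdiff_eq (tdiff_comp (hP _) (rdiff_hor y x)); rewrite ?mulr1.
have Ev x a b : 'i * vseg h x a b = P (x +i* b) - P (x +i* a).
  rewrite /vseg -cintZ => [|t]; last exact: rcont_ver.
  apply: (cint_prim (G := fun y => P (x +i* y))) => y *.
    by apply: tcontM (tcont_cst _ _ _) _; exact: rcont_ver.
  by apply: tdiff_eq (tdiff_comp (hP _) (rdiff_ver x y)); rewrite // mulrC.
by rewrite /rint !Ev !Eh; ring.
Qed.

Definition inrect x0 x1 y0 y1 (z : R[i]) :=
  (Num.min x0 x1 <= complex.Re z <= Num.max x0 x1) &&
  (Num.min y0 y1 <= complex.Im z <= Num.max y0 y1).

Lemma rint_bound h x0 x1 y0 y1 M : (forall z, ccont h z) ->
  (forall z, inrect x0 x1 y0 y1 z -> nrm (h z) <= M) ->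
  nrm (rint h x0 x1 y0 y1) <= 2 * M * (`|x1 - x0| + `|y1 - y0|).
Proof.
move=> hc hM.
have Bh y : y = y0 \/ y = y1 -> nrm (hseg h y x0 x1) <= M * `|x1 - x0|.
  move=> yy; apply: cint_bound => x; first exact: rcont_hor.
  move=> xx; apply: hM; rewrite /inrect /= xx /=.
  by case: yy => ->; rewrite ge_min le_max lexx ?orbT.
have Bv x : x = x0 \/ x = x1 -> nrm ('i * vseg h x y0 y1) <= M * `|y1 - y0|.
  move=> xx; rewrite nrmM nrm_i mul1r; apply: cint_bound => y; first exact: rcont_ver.
  move=> yy; apply: hM; rewrite /inrect /= yy andbT.
  by case: xx => ->; rewrite ge_min le_max lexx ?orbT.
rewrite /rint; apply: le_trans (nrmB _ _) _.
have := nrmB (hseg h y0 x0 x1 + 'i * vseg h x1 y0 y1) (hseg h y1 x0 x1).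
have := nrmD (hseg h y0 x0 x1) ('i * vseg h x1 y0 y1).
have := Bh y0 (or_introl erefl); have := Bh y1 (or_intror erefl).
have := Bv x0 (or_introl erefl); have := Bv x1 (or_intror erefl).
lra.
Qed.

Lemma rintB h g x0 x1 y0 y1 : (forall z, ccont h z) -> (forall z, ccont g z) ->
  rint (fun z => h z - g z) x0 x1 y0 y1 = rint h x0 x1 y0 y1 - rint g x0 x1 y0 y1.
Proof.
move=> hc gc.
have E a b (u v : R -> R[i]) : (forall x, rcont u x) -> (forall x, rcont v x) ->
    cint a b (fun x => u x - v x) = cint a b u - cint a b v.
  move=> uc vc; rewrite -mulN1r -cintZ // -cintD // => [|x].
    by congr cint; apply: funext => x; rewrite mulN1r.
  by apply: tcontM (tcont_cst _ _ _) (vc x).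
rewrite /rint /hseg /vseg !E; first by ring.
all: by move=> x; first [exact: rcont_hor|exact: rcont_ver].
Qed.

Lemma cdiff_affine (a b c z : R[i]) : cdiff (fun z => a + b * (z - c)) z b.
Proof.
apply: tdiff_eq (tdiffD (tdiff_cst _ a z)
  (tdiffZ b (tdiffB (tdiff_id _ z) (tdiff_cst _ c z)))) => //.
by rewrite add0r subr0 mulr1.
Qed.

Lemma cdiff_quad (a b c z : R[i]) :
  cdiff (fun z => a * z + b / 2 * (z - c) ^+ 2) z (a + b * (z - c)).
Proof.
have h : cdiff (fun z => z - c) z 1.
  by apply: tdiff_eq (tdiffB (tdiff_id _ z) (tdiff_cst _ c z)); rewrite ?subr0.
apply: tdiff_eq (tdiffD (tdiffZ a (tdiff_id _ z)) (tdiffZ (b / 2) (tdiffM h h))) => //.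
by rewrite mulr1; field.
Qed.

(** A rectangle scaled by [k] is bad when its integral exceeds [e * k ^+ 2]; four good quarters make
    a good rectangle. Near the limit point, [h] differs from an affine function, whose integral
    vanishes, by a small multiple of the diameter, which rules out small bad rectangles. *)
Lemma goursat_pos h x0 y0 w v : 0 <= w -> 0 <= v -> (forall z, ccont h z) ->
  (forall z, inrect x0 (x0 + w) y0 (y0 + v) z -> exists l, cdiff h z l) ->
  rint h x0 (x0 + w) y0 (y0 + v) = 0.
Proof.
move=> w0 v0 hc hd.
apply/eqP; rewrite -nrm_eq0 eq_le nrm_ge0 andbT; apply/ler_addgt0Pr => e e0.
rewrite add0r leNgt; apply/negP => Bad.
pose B x y k := e * k ^+ 2 < nrm (rint h x (x + k * w) y (y + k * v)).
apply: (@rect_bisect B x0 y0 w v) => //; last first.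
- by rewrite /B expr1n mulr1 !mul1r.
- move=> cx cy cx0 cy0.
  have [|l hl] := hd (cx +i* cy).
    by rewrite /inrect /= !min_l ?max_r ?lerDl // cx0.
  (* [k * S] bounds both the half perimeter and the distance to the limit point; the summand 1 keeps
     [S] positive for degenerate rectangles. The remainder integral is then at most [2 * (e / (2 * S
     ^+ 2) * (k * S)) * (k * S)], that is [e * k ^+ 2]. *)
  pose S := w + v + 1; have S0 : 0 < S by rewrite /S; lra.
  have e10 : 0 < e / (2 * S ^+ 2) by rewrite divr_gt0 // mulr_gt0 // exprn_gt0.
  have [d d0 H] := hl _ e10.
  exists (d / S); first by rewrite divr_gt0.
  move=> x y k /andP[k0 kd] _ xc _ _ yc _; rewrite /B; apply/negP; rewrite -leNgt.
  have kw : 0 <= k * w by rewrite mulr_ge0 // ltW.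
  have kv : 0 <= k * v by rewrite mulr_ge0 // ltW.
  set a := h (cx +i* cy).
  have pc z : ccont (fun z => a + l * (z - (cx +i* cy))) z.
    exact: tdiff_tcont (cdiff_affine _ _ _ _).
  have E := rintB x (x + k * w) y (y + k * v) hc pc.
  rewrite (rint_prim _ _ _ _ pc (cdiff_quad a l (cx +i* cy))) subr0 in E.
  rewrite -E.
  have hk : k * S < d by rewrite -ltr_pdivlMr.
  have -> : e * k ^+ 2 = 2 * (e / (2 * S ^+ 2) * (k * S)) * (k * S) by field; rewrite gt_eqF.
  apply: le_trans (rint_bound (M := e / (2 * S ^+ 2) * (k * S)) _ _) _.
  + by move=> z; apply: tcontB (hc z) (pc z).
  + move=> z; rewrite /inrect !min_l ?max_r ?lerDl // => /andP[zx zy].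
    have zc : nrm (z - (cx +i* cy)) <= k * S.
      rewrite (le_trans (nrm_leD _)) // !cE /= /S !mulrDr mulr1.
      rewrite (_ : k * w + k * v + k = k * w + (k * v + k)) ?addrA // -addrA lerD //.
        by rewrite ler_norml; lra.
      by rewrite ler_norml; lra.
    have := H z; rewrite opprD addrA => /(_ (le_lt_trans zc hk)) /le_trans; apply.
    by rewrite ler_wpM2l // ltW.
  + rewrite !(addrC _ (_ * _)) !addrK !ger0_norm // ler_wpM2l //.
      by have := mulr_gt0 e10 (mulr_gt0 k0 S0); lra.
    by rewrite /S !mulrDr mulr1 lerDl ltW.
- move=> x y k k0 Bk; rewrite /B in Bk.
  have [//|nB] := pselect (exists2 p : R * R, (p.1 = x \/ p.1 = x + k / 2 * w) /\
                     (p.2 = y \/ p.2 = y + k / 2 * v) & B p.1 p.2 (k / 2)).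
  exfalso; move: Bk; apply/negP; rewrite -leNgt.
  have nb p1 p2 : (p1 = x \/ p1 = x + k / 2 * w) -> (p2 = y \/ p2 = y + k / 2 * v) ->
     nrm (rint h p1 (p1 + k / 2 * w) p2 (p2 + k / 2 * v)) <= e * (k / 2) ^+ 2.
    by move=> h1 h2; rewrite leNgt; apply/negP => h3; apply: nB; exists (p1, p2).
  have n1 := nb x y (or_introl erefl) (or_introl erefl).
  have n2 := nb _ y (or_intror erefl) (or_introl erefl).
  have n3 := nb x _ (or_introl erefl) (or_intror erefl).
  have n4 := nb _ _ (or_intror erefl) (or_intror erefl).
  have Ew : x + k / 2 * w + k / 2 * w = x + k * w by field.
  have Ev : y + k / 2 * v + k / 2 * v = y + k * v by field.
  rewrite Ew Ev in n2 n3 n4.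
  rewrite (rint_splitx _ _ (x + k / 2 * w)).
  rewrite (rint_splity h x _ _ (y + k / 2 * v)) (rint_splity h _ (x + k * w) _ (y + k / 2 * v)).
  have -> : e * k ^+ 2 = 4 * (e * (k / 2) ^+ 2) by field.
  apply: (le_trans (nrmD _ _)).
  have := nrmD (rint h x (x + k / 2 * w) y (y + k / 2 * v))
      (rint h x (x + k / 2 * w) (y + k / 2 * v) (y + k * v)).
  have := nrmD (rint h (x + k / 2 * w) (x + k * w) y (y + k / 2 * v))
      (rint h (x + k / 2 * w) (x + k * w) (y + k / 2 * v) (y + k * v)).
  lra.
Qed.

Lemma goursat h x0 x1 y0 y1 : (forall z, ccont h z) ->
  (forall z, inrect x0 x1 y0 y1 z -> exists l, cdiff h z l) ->
  rint h x0 x1 y0 y1 = 0.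
Proof.
have P a b c d : a <= b -> c <= d -> (forall z, ccont h z) ->
  (forall z, inrect a b c d z -> exists l, cdiff h z l) ->
  rint h a b c d = 0.
  move=> ab cd hc; have := @goursat_pos h a c (b - a) (d - c).
  by rewrite !subr_ge0 ![_ + (_ - _)]addrC !subrK => /(_ ab cd hc).
have minmax (a b : R) : Num.min b a = Num.min a b /\ Num.max b a = Num.max a b.
  by rewrite minC maxC.
move=> hc hd.
have sx : inrect x1 x0 =  inrect x0 x1 by rewrite /inrect (minmax x0 x1).1 (minmax x0 x1).2.
have sy : inrect x0 x1 y1 y0 =  inrect x0 x1 y0 y1.
  by rewrite /inrect (minmax y0 y1).1 (minmax y0 y1).2.
have [x01|/ltW x01] := leP x0 x1; have [y01|/ltW y01] := leP y0 y1.
- exact: P.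
- by rewrite rint_swapy P ?oppr0 // sy.
- by rewrite rint_swapx P ?oppr0 // sx.
- by rewrite rint_swapy rint_swapx P ?oppr0 // sx sy.
Qed.

End Goursat.

(** * Primitives of holomorphic functions on a square *)

Section Primitive.
Variable R : realType.
Local Notation nrm := (@nrm R).
Implicit Types (h : R[i] -> R[i]) (x y : R).

Lemma inrect_sub x0 x1 y0 y1 x0' x1' y0' y1' (z : R[i]) :
  Num.min x0 x1 <= x0' <= Num.max x0 x1 -> Num.min x0 x1 <= x1' <= Num.max x0 x1 ->
  Num.min y0 y1 <= y0' <= Num.max y0 y1 -> Num.min y0 y1 <= y1' <= Num.max y0 y1 ->
  inrect x0' x1' y0' y1' z -> inrect x0 x1 y0 y1 z.
Proof.
move=> /andP[a1 a2] /andP[b1 b2] /andP[c1 c2] /andP[d1 d2].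
move=> /andP[/andP[h1 h2] /andP[h3 h4]].
apply/andP; split; apply/andP; split.
- by apply: le_trans h1; rewrite le_min a1.
- by apply: (le_trans h2); rewrite ge_max a2.
- by apply: le_trans h3; rewrite le_min c1.
- by apply: (le_trans h4); rewrite ge_max c2.
Qed.

Lemma between_conv (a b d : R) : 0 < d < 1 ->
  Num.min a b <= a + d * (b - a) <= Num.max a b.
Proof.
move=> /andP[d0 d1]; have [ab|ab] := leP a b.
  by apply/andP; split; nra.
by apply/andP; split; nra.
Qed.

Lemma conv_out (a b d t : R) : 0 < d < 1 -> a != b ->
  Num.min (a + d * (b - a)) b <= t <= Num.max (a + d * (b - a)) b -> t != a.
Proof.
move=> /andP[d0 d1] ab; apply: contraTneq => ->.
have [ab'|ab'] := ltP a b.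
  have -> : Num.min (a + d * (b - a)) b = a + d * (b - a) by apply: min_l; nra.
  by rewrite negb_and -ltNge; apply/orP; left; nra.
have ab2 : b < a by rewrite lt_def ab.
have -> : Num.max (a + d * (b - a)) b = a + d * (b - a) by apply: max_l; nra.
by rewrite negb_and -!ltNge; apply/orP; right; nra.
Qed.

Lemma between_l (a b : R) : Num.min a b <= a <= Num.max a b.
Proof. by rewrite ge_min le_max lexx. Qed.

Lemma between_r (a b : R) : Num.min a b <= b <= Num.max a b.
Proof. by rewrite ge_min le_max lexx !orbT. Qed.

Lemma between_dist (a b t : R) : Num.min a b <= t <= Num.max a b ->
  `|t - a| <= `|b - a|.
Proof.
have [ab|ab] := leP a b => /andP[t1 t2].
  by rewrite !ger0_norm ?subr_ge0 // lerB.
by rewrite !ler0_norm ?subr_le0 ?(ltW ab) // lerN2 lerB.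
Qed.

Lemma rint_degx h x y0 y1 : rint h x x y0 y1 = 0.
Proof. by rewrite /rint /hseg /cint; ring. Qed.

Lemma rint_degy h x0 x1 y : rint h x0 x1 y y = 0.
Proof. by rewrite /rint /vseg /cint; ring. Qed.

(* Only continuity is required at the corner [(x0, y0)]: shrinking rectangles at
   this corner have negligible boundary integrals. *)
Lemma goursat_corner h x0 x1 y0 y1 : (forall z, ccont h z) ->
  (forall z, inrect x0 x1 y0 y1 z -> z != x0 +i* y0 -> exists l, cdiff h z l) ->
  rint h x0 x1 y0 y1 = 0.
Proof.
move=> hc hd.
have [<-|x01] := eqVneq x0 x1; first exact: rint_degx.
have [<-|y01] := eqVneq y0 y1; first exact: rint_degy.
have [d0 d00 Hd] := hc (x0 +i* y0) _ ltr01.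
set M := nrm (h (x0 +i* y0)) + 1.
pose W := `|x1 - x0| + `|y1 - y0|.
have W0 : 0 <= W by rewrite addr_ge0.
have M0 : 0 <= M by rewrite addr_ge0 ?nrm_ge0.
have small d : 0 < d < 1 -> d * W < d0 -> nrm (rint h x0 x1 y0 y1) <= 2 * M * (d * W).
  move=> d01 dW; have /andP[dp d1] := d01.
  set xd := x0 + d * (x1 - x0); set yd := y0 + d * (y1 - y0).
  have bx := between_conv x0 x1 d01; have by' := between_conv y0 y1 d01.
  rewrite (rint_splity _ _ _ _ yd) (rint_splitx h x0 xd).
  rewrite (@goursat _ h xd x1) ?addr0 => //; last first.
    move=> z zr; apply: hd; first by apply: inrect_sub zr; rewrite ?between_l ?between_r.
    apply: contraTneq zr => ->; rewrite /inrect /=; apply/negP => /andP[c _].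
    by move/negP: (conv_out d01 x01 c); apply.
  rewrite (@goursat _ h x0 x1 yd) ?addr0 => //; last first.
    move=> z zr; apply: hd; first by apply: inrect_sub zr; rewrite ?between_l ?between_r.
    apply: contraTneq zr => ->; rewrite /inrect /=; apply/negP => /andP[_ c].
    by move/negP: (conv_out d01 y01 c); apply.
  have E1 : `|xd - x0| = d * `|x1 - x0|.
    by rewrite /xd addrC addKr normrM gtr0_norm.
  have E2 : `|yd - y0| = d * `|y1 - y0|.
    by rewrite /yd addrC addKr normrM gtr0_norm.
  have -> : d * W = `|xd - x0| + `|yd - y0| by rewrite E1 E2 mulrDr.
  apply: rint_bound => // z zr; rewrite -[h z](subrK (h (x0 +i* y0))).
  rewrite (le_trans (nrmD _ _)) // addrC lerD2l Hd //.
  rewrite (le_lt_trans (nrm_leD _)) // (le_lt_trans _ dW) // !cE /= /W mulrDr -E1 -E2.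
  by case/andP: zr => zx zy; rewrite lerD // between_dist.
apply/eqP; rewrite -nrm_eq0 eq_le nrm_ge0 andbT; apply/ler_addgt0Pr => e e0; rewrite add0r.
(* The three bounds keep the corner rectangle proper, keep it inside the radius of continuity at the
   corner, and make its boundary integral at most [e]. *)
pose d := Num.min (1 / 2) (Num.min (d0 / 2 / (W + 1)) (e / (2 * M + 1) / (W + 1))).
have W1 : 0 < W + 1 by lra.
have M1 : 0 < 2 * M + 1 by lra.
have d1 : d <= 1 / 2 by rewrite ge_min lexx.
have dp : 0 < d by rewrite !lt_min !divr_gt0.
have d2 : d * (W + 1) <= d0 / 2.
  by rewrite -ler_pdivlMr // /d !ge_min lexx !orbT.
have d3 : d * (W + 1) * (2 * M + 1) <= e.
  by rewrite -!ler_pdivlMr // /d !ge_min lexx !orbT.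
apply: (le_trans (small d _ _)).
- by rewrite dp; lra.
- by rewrite mulrDr mulr1 in d2; lra.
- apply: le_trans d3; rewrite mulrC ler_pM //; last by rewrite lerDl.
    by rewrite mulr_ge0 // ltW.
  by rewrite mulr_ge0.
  by rewrite ler_wpM2l ?(ltW dp) // lerDl.
Qed.

Definition clamp (s t : R) := Num.max (- s) (Num.min s t).

Lemma clamp_lip s t u : `|clamp s t - clamp s u| <= `|t - u|.
Proof.
rewrite /clamp; wlog tu : t u / t <= u.
  move=> H; have [/H//|/ltW/H h] := leP t u.
  by rewrite distrC (distrC t u).
have h1 : Num.min s t <= Num.min s u by rewrite le_min !ge_min lexx tu orbT.
have h2 : Num.min s u - Num.min s t <= u - t.
  rewrite lerBlDr addrC; rewrite -[X in _ <= X]addrC.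
  have [st|st] := leP s t; first by rewrite ge_min; apply/orP; left; lra.
  by rewrite ge_min; apply/orP; right; lra.
have h3 : Num.max (- s) (Num.min s t) <= Num.max (- s) (Num.min s u).
  by rewrite ge_max !le_max lexx h1 orbT.
rewrite distrC ger0_norm ?subr_ge0 // distrC ger0_norm ?subr_ge0 //.
rewrite lerBlDr ge_max; apply/andP; split.
  have : - s <= Num.max (- s) (Num.min s t) by rewrite le_max lexx.
  lra.
have : Num.min s t <= Num.max (- s) (Num.min s t) by rewrite le_max lexx orbT.
lra.
Qed.

Lemma clamp_id s t : `|t| <= s -> clamp s t = t.
Proof. by rewrite ler_norml => /andP[a b]; rewrite /clamp (min_r b) max_r. Qed.

Lemma clamp_in s t : 0 <= s -> `|clamp s t| <= s.
Proof.
move=> s0; rewrite ler_norml /clamp le_max lexx /= ge_max ge_min lexx andbT; lra.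
Qed.

(** A retraction of the plane onto a closed square. Composition with it makes a function that is
    continuous on the square continuous everywhere, as [cint] requires, without changing it on the
    square. *)
Definition cclamp s (z : R[i]) := clamp s (complex.Re z) +i* clamp s (complex.Im z).

Lemma ccont_cclamp s z : ccont (cclamp s) z.
Proof.
move=> e e0; exists (e / 2); first by rewrite divr_gt0.
move=> w wz; rewrite (le_trans (nrm_leD _)) // /cclamp !cE /=.
have := clamp_lip s (complex.Re w) (complex.Re z).
have := clamp_lip s (complex.Im w) (complex.Im z).
have := Re_le_nrm (w - z); have := Im_le_nrm (w - z); rewrite !cE.
lra.
Qed.

Definition csq s (z : R[i]) := `|complex.Re z| <= s /\ `|complex.Im z| <= s.
Definition osq s (z : R[i]) := `|complex.Re z| < s /\ `|complex.Im z| < s.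

Lemma osq_open s z : osq s z ->
  exists2 d, 0 < d & forall w, nrm (w - z) < d -> osq s w.
Proof.
move=> [zx zy]; exists (Num.min (s - `|complex.Re z|) (s - `|complex.Im z|)).
  by rewrite lt_min !subr_gt0 zx.
move=> w; rewrite lt_min => /andP[w1 w2].
have := Re_le_nrm (w - z); have := Im_le_nrm (w - z); rewrite !cE => h1 h2.
have := ler_normD (complex.Re w - complex.Re z) (complex.Re z).
have := ler_normD (complex.Im w - complex.Im z) (complex.Im z).
by rewrite !subrK => h3 h4; split; lra.
Qed.

(** The primitive integrates along an L-shaped path from [p]. The two such paths to a point bound a
    rectangle with corner [p], where continuity is enough; allowing this exceptional point makes the
    result apply to difference quotients at [p]. *)
Lemma primitive_square h s p : osq s p -> (forall z, csq s z -> ccont h z) ->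
  (forall z, csq s z -> z != p -> exists l, cdiff h z l) ->
  exists G, forall z, osq s z -> cdiff G z (h z).
Proof.
move=> ps hc hd; have s0 : 0 < s by apply: le_lt_trans ps.1.
pose k z := h (cclamp s z).
have kc z : ccont k z.
  apply: (@tcont_comp _ _ _ h) (ccont_cclamp s z); apply: hc.
  by split; rewrite clamp_in // ltW.
have idc z : osq s z -> cclamp s z = z.
  by move=> [zx zy]; rewrite /cclamp !clamp_id ?ltW //; case: (z).
have kh z : osq s z -> k z = h z by move=> zs; rewrite /k idc.
have kd z : osq s z -> z != p -> exists l, cdiff k z l.
  move=> zs zp; have [|l hl] := hd z _ zp; first by split; rewrite ltW //; case: zs.
  exists l; apply: tdiff_near hl; have [d d0 H] := osq_open zs.
  by exists d => // w /H/kh ->.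
set p1 := complex.Re p; set p2 := complex.Im p.
have Ep : p = p1 +i* p2 by rewrite /p1 /p2; case: (p).
pose G (z : R[i]) := hseg k p2 p1 (complex.Re z) + 'i * vseg k (complex.Re z) p2 (complex.Im z).
have rectin (a b c d : R) z : `|a| < s -> `|b| < s -> `|c| < s -> `|d| < s ->
    inrect a b c d z -> osq s z.
  move=> as' bs cs ds /andP[/andP[x1 x2] /andP[y1 y2]].
  move: as' bs cs ds; rewrite !ltr_norml => /andP[a1 a2] /andP[b1 b2] /andP[c1 c2] /andP[d1 d2].
  split; rewrite ltr_norml; apply/andP; split.
  - by apply: lt_le_trans x1; rewrite lt_min a1.
  - by apply: (le_lt_trans x2); rewrite gt_max a2.
  - by apply: lt_le_trans y1; rewrite lt_min c1.
  - by apply: (le_lt_trans y2); rewrite gt_max c2.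
have G2 z : osq s z -> G z = 'i * vseg k p1 p2 (complex.Im z) +
    hseg k (complex.Im z) p1 (complex.Re z).
  move=> zs; have : rint k p1 (complex.Re z) p2 (complex.Im z) = 0.
    apply: goursat_corner => // w wr; rewrite -Ep; apply: kd.
    by apply: rectin wr; rewrite ?(zs.1) ?(zs.2) ?(ps.1) ?(ps.2).
  rewrite /rint /G => /eqP; rewrite subr_eq0 => /eqP <-; ring.
exists G => z zs e e0.
have e20 : 0 < e / 2 by rewrite divr_gt0.
have [d d0 H] := kc z _ e20; have [d' d'0 H'] := osq_open zs.
exists (Num.min d' (d / 2)); first by rewrite lt_min d'0 divr_gt0.
move=> w; rewrite lt_min => /andP[/H' ws wd]; rewrite /= in wd *.
set z1 := complex.Re z; set z2 := complex.Im z.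
set w1 := complex.Re w; set w2 := complex.Im w.
have xy : osq s (w1 +i* z2) by split; [exact: ws.1|exact: zs.2].
(* The horizontal increment is read on the path that ends horizontally, the vertical one on the path
   that ends vertically. *)
have E1 : G (w1 +i* z2) - G z = hseg k z2 z1 w1.
  by rewrite !G2 // /hseg /= -(cint_split p1 z1 w1) /z2 -/z1; ring.
have E2 : G w - G (w1 +i* z2) = 'i * vseg k w1 z2 w2.
  by rewrite /G /vseg /= -/w1 -/w2 -(cint_split p2 z2 w2); ring.
have -> : G w - G z = hseg k z2 z1 w1 + 'i * vseg k w1 z2 w2.
  by rewrite -E1 -E2; ring.
have dx := Re_le_nrm (w - z); have dy := Im_le_nrm (w - z).
rewrite !cE -/w1 -/w2 -/z1 -/z2 in dx dy.
have clo (u : R[i]) : inrect z1 w1 z2 w2 u -> nrm (k u - k z) <= e / 2.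
  move=> /andP[ux uy]; apply: H; rewrite (le_lt_trans (nrm_leD _)) // !cE /= -/z1 -/z2.
  have := between_dist ux; have := between_dist uy; lra.
have Eh : hseg k z2 z1 w1 - h z * (w1 - z1)%:C =
    cint z1 w1 (fun x => k (x +i* z2) + - h z).
  rewrite cintD => [|x|x]; [|exact: rcont_hor|exact: tcont_cst].
  by rewrite cint_cst mulNr.
have Ev : vseg k w1 z2 w2 - h z * (w2 - z2)%:C =
    cint z2 w2 (fun y => k (w1 +i* y) + - h z).
  rewrite cintD => [|x|x]; [|exact: rcont_ver|exact: tcont_cst].
  by rewrite cint_cst mulNr.
have -> : hseg k z2 z1 w1 + 'i * vseg k w1 z2 w2 - h z * (w - z) =
  (hseg k z2 z1 w1 - h z * (w1 - z1)%:C) + 'i * (vseg k w1 z2 w2 - h z * (w2 - z2)%:C).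
  have -> : w - z = (w1 - z1)%:C + 'i * (w2 - z2)%:C.
    by apply: c_eq; rewrite !cE /= -?/w1 -?/w2 -?/z1 -?/z2; ring.
  ring.
rewrite Eh Ev (le_trans (nrmD _ _)) // nrmM nrm_i mul1r.
have rch x : rcont (fun x => k (x +i* z2) + - h z) x.
  by apply: tcontD (rcont_hor _ _ kc) (tcont_cst _ _ _).
have rcv x : rcont (fun x => k (w1 +i* x) + - h z) x.
  by apply: tcontD (rcont_ver _ _ kc) (tcont_cst _ _ _).
have := cint_bound (a := z1) (b := w1) (M := e / 2) rch.
have := cint_bound (a := z2) (b := w2) (M := e / 2) rcv.
rewrite -(kh z zs) => B1 B2.
have {}B1 : nrm (cint z2 w2 (fun x => k (w1 +i* x) + - k z)) <= e / 2 * `|w2 - z2|.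
  by apply: B1 => y yy; apply: clo; rewrite /inrect /= yy between_r.
have {}B2 : nrm (cint z1 w1 (fun x => k (x +i* z2) + - k z)) <= e / 2 * `|w1 - z1|.
  by apply: B2 => y yy; apply: clo; rewrite /inrect /= yy between_l.
have := ler_wpM2l (ltW e20) dx; have := ler_wpM2l (ltW e20) dy.
by move: B1 B2; lra.
Qed.

End Primitive.

(** * Cauchy's integral formula *)

Lemma geometric_le0 (R : realType) (q C x : R) : 0 <= q < 1 ->
  (forall N, x <= q ^+ N * C) -> x <= 0.
Proof.
move=> /andP[q0 q1] H.
have qc : (fun n => q ^+ n * C) @ \oo --> (0 * C : R).
  by apply: cvgMl; apply: cvg_expr; rewrite ger0_norm.
rewrite mul0r in qc; rewrite -(cvg_lim _ qc) //.
apply: limr_ge; first by apply/cvg_ex; exists 0.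
by near=> n; exact: H.
Unshelve. all: by end_near. Qed.

Section Circle.
Variable R : realType.
Local Notation nrm := (@nrm R).
Implicit Types (f h : R[i] -> R[i]) (z w : R[i]).

Lemma tdiffX T (i : T -> R[i]) (f : T -> R[i]) t l n : tdiff i f t l ->
  tdiff i (fun s => f s ^+ n) t (n%:R * f t ^+ n.-1 * l).
Proof.
move=> fl; elim: n => [|n IH].
  by apply: tdiff_eq (tdiff_cst _ 1 t) => [s|]; rewrite ?mul0r // expr0.
apply: tdiff_eq (tdiffM fl IH) => [s|]; first by rewrite exprS.
case: n {IH} => [|n] /=; first by rewrite expr0; ring.
by rewrite exprS -[n.+2%:R]natr1; ring.
Qed.

Definition circ (r t : R) : R[i] := (r * cos t) +i* (r * sin t).

Lemma nrm_circ r t : 0 <= r -> nrm (circ r t) = r.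
Proof.
move=> r0; rewrite nrmE /= !exprMn -mulrDr cos2Dsin2 mulr1 sqrtr_sqr.
exact: ger0_norm.
Qed.

Lemma circ_neq0 r t : 0 < r -> circ r t != 0.
Proof. by move=> r0; rewrite -nrm_gt0 nrm_circ // ltW. Qed.

Lemma circ_per r : circ r (pi *+ 2) = circ r 0.
Proof. by rewrite /circ cos2pi sin2pi cos0 sin0. Qed.

Lemma rdiff_circ r t : rdiff (circ r) t ('i * circ r t).
Proof.
apply: tdiff_eq (tdiffD (tdiffZ r%:C (rdiff_real (is_derive_cos t)))
  (tdiffZ ('i * r%:C) (rdiff_real (is_derive_sin t)))) => [s|].
  by apply: c_eq; rewrite /circ !cE /=; ring.
by apply: c_eq; rewrite /circ !cE /=; ring.
Qed.

Lemma rcont_circ r t : rcont (circ r) t.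
Proof. exact: tdiff_tcont (rdiff_circ r t). Qed.

Definition mean (g : R -> R[i]) : R[i] := (pi *+ 2)^-1%:C * cint 0 (pi *+ 2) g.

Lemma pi2_gt0 : 0 < pi *+ 2 :> R.
Proof. by rewrite mulrn_wgt0 ?pi_gt0. Qed.

Lemma meanD g k : (forall t, rcont g t) -> (forall t, rcont k t) ->
  mean (fun t => g t + k t) = mean g + mean k.
Proof. by move=> gc kc; rewrite /mean cintD // mulrDr. Qed.

Lemma meanZ c g : (forall t, rcont g t) -> mean (fun t => c * g t) = c * mean g.
Proof. by move=> gc; rewrite /mean cintZ // mulrCA. Qed.

Lemma mean_bound M g : (forall t, rcont g t) -> (forall t, nrm (g t) <= M) ->
  nrm (mean g) <= M.
Proof.
move=> gc gM; rewrite nrmM nrm_real gtr0_norm ?invr_gt0 ?pi2_gt0 //.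
rewrite ler_pdivrMl ?pi2_gt0 // mulrC.
have := cint_bound (a := 0) (b := pi *+ 2) gc (fun x _ => gM x).
by rewrite subr0 gtr0_norm ?pi2_gt0.
Qed.

Lemma mean_cst c : mean (fun=> c) = c.
Proof.
rewrite /mean cint_cst subr0 mulrCA -rmorphM /= mulVf ?mulr1 //.
by rewrite gt_eqF ?pi2_gt0.
Qed.

Lemma mean_prim g G : (forall t, rcont g t) -> (forall t, rdiff G t (g t)) ->
  G (pi *+ 2) = G 0 -> mean g = 0.
Proof.
move=> gc Gg G0; rewrite /mean (@cint_prim _ _ _ g G) //.
by rewrite G0 subrr mulr0.
Qed.

Lemma mean_inv_pow r n : 0 < r -> mean (fun t => (circ r t)^-1 ^+ n.+1) = 0.
Proof.
move=> r0.
have iN0 : 'i != 0 :> R[i] by rewrite -nrm_gt0 nrm_i.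
have nN0 : n.+1%:R != 0 :> R[i] by rewrite pnatr_eq0.
have du t : rdiff (fun t => (circ r t)^-1) t (- 'i * (circ r t)^-1).
  apply: tdiff_eq (tdiffV (circ_neq0 t r0) (rdiff_circ r t)) => //.
  by field; exact: circ_neq0.
have dn t : rdiff (fun t => (circ r t)^-1 ^+ n.+1) t
    (- 'i * n.+1%:R * (circ r t)^-1 ^+ n.+1).
  apply: tdiff_eq (tdiffX n.+1 (du t)) => //=.
  by rewrite exprS; ring.
apply: (mean_prim (G := fun t => (- 'i * n.+1%:R)^-1 * (circ r t)^-1 ^+ n.+1)).
- by move=> t; exact: tdiff_tcont (dn t).
- move=> t; apply: tdiff_eq (tdiffZ (- 'i * n.+1%:R)^-1 (dn t)) => //.
  by rewrite mulKf // mulf_neq0 // oppr_eq0.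
- by rewrite circ_per.
Qed.

Lemma circ_sub_neq0 r t w : nrm w < r -> circ r t - w != 0.
Proof.
move=> wr; have r0 : 0 <= r by apply: le_trans (nrm_ge0 w) (ltW wr).
rewrite -nrm_gt0 (lt_le_trans _ (nrm_rev _ _)) // nrm_circ // subr_gt0 //.
Qed.

(** With [E n] the mean of the kernel times the n-th power of 1 / zeta on the circle, one step of
    the geometric expansion gives [E n] = mean of that power + [w * E n.+1]. The means of the
    positive powers vanish, so [E 1] is [w ^+ n * E n.+1], which tends to 0, and [E 0] is 1. No
    series is integrated term by term. *)
Lemma mean_cauchy_kernel r w : 0 < r -> nrm w < r ->
  mean (fun t => circ r t / (circ r t - w)) = 1.
Proof.
move=> r0 wr.
pose E n := mean (fun t => (circ r t)^-1 ^+ n * (circ r t / (circ r t - w))).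
have uc t : rcont (fun t => (circ r t)^-1) t.
  by apply: tcontV (rcont_circ r t); exact: circ_neq0.
have unc n t : rcont (fun t => (circ r t)^-1 ^+ n) t.
  elim: n => [|n IH]; first exact: tcont_cst.
  by apply: tcont_near (tcontM (uc t) IH); exists 1 => // s _; rewrite exprS.
have kc t : rcont (fun t => circ r t / (circ r t - w)) t.
  apply: tcontM (rcont_circ r t) _; apply: tcontV.
    exact: circ_sub_neq0.
  exact: tcontB (rcont_circ r t) (tcont_cst _ _ _).
have Ec n t : rcont (fun t => (circ r t)^-1 ^+ n * (circ r t / (circ r t - w))) t.
  exact: tcontM (unc n t) (kc t).
have ES n : E n = mean (fun t => (circ r t)^-1 ^+ n) + w * E n.+1.
  rewrite /E -meanZ // -meanD //; last first.
    by move=> t; exact: tcontM (tcont_cst _ _ _) (Ec n.+1 t).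
  congr mean; apply: funext => t; rewrite exprS.
  have c0 := circ_neq0 t r0; have c1 := circ_sub_neq0 t wr.
  have {1}-> : circ r t / (circ r t - w) =
    1 + w * ((circ r t)^-1 * (circ r t / (circ r t - w))) by field; rewrite ?c0 ?c1.
  by ring.
have E1 n : E 1 = w ^+ n * E n.+1.
  elim: n => [|n IH]; first by rewrite mul1r.
  by rewrite IH ES mean_inv_pow // add0r exprSr mulrA.
have E10 : E 1%N = 0.
  apply/eqP; rewrite -nrm_eq0 eq_le nrm_ge0 andbT.
  apply: (@geometric_le0 _ (nrm w / r) (r - nrm w)^-1) => [|n].
    by rewrite divr_ge0 ?nrm_ge0 ?(ltW r0) // ltr_pdivrMr // mul1r.
  rewrite (E1 n) nrmM nrmX expr_div_n -mulrA ler_wpM2l ?exprn_ge0 ?nrm_ge0 //.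
  apply: mean_bound => t; first exact: Ec.
  rewrite nrmM nrmX nrmM !nrmV nrm_circ ?(ltW r0) //.
  rewrite exprSr exprVn -!mulrA mulKf ?gt_eqF // ler_wpM2l ?invr_ge0 ?exprn_ge0 ?(ltW r0) //.
  rewrite lef_pV2 ?posrE ?nrm_gt0 ?circ_sub_neq0 ?subr_gt0 //.
  by rewrite (le_trans _ (nrm_rev _ _)) // nrm_circ // ltW.
have : E 0%N = 1.
  rewrite ES E10 mulr0 addr0 (_ : (fun t => _) = fun=> 1) ?mean_cst //.
by move=> <-; rewrite /E; congr mean; apply: funext => t; rewrite expr0 mul1r.
Qed.

(** The factor 6/5 exceeds 1 while 6/5 times sqrt 2 is less than 2: the square fits between the
    closed disk of radius [r] and the open disk of radius [2 * r]. *)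
Lemma csq_nrm (r : R) z : 0 < r -> csq (6 / 5 * r) z -> nrm z < 2 * r.
Proof.
move=> r0 [zx zy]; rewrite -(@ltr_pXn2r _ 2) ?nnegrE ?nrm_ge0 ?mulr_ge0 ?(ltW r0) //.
rewrite nrm_sqr -(real_normK (num_real (complex.Re z))) -(real_normK (num_real (complex.Im z))).
have := normr_ge0 (complex.Re z); have := normr_ge0 (complex.Im z); nra.
Qed.

Lemma osq_nrm (r : R) z : 0 < r -> nrm z <= r -> osq (6 / 5 * r) z.
Proof.
move=> r0 zr; have := Re_le_nrm z; have := Im_le_nrm z.
by split; lra.
Qed.

(** The difference quotient of [f] at [z], completed by the derivative, is continuous at [z] and
    differentiable elsewhere; it has a primitive on a square around the circle, so its contour
    integral vanishes. What is left is [f z] times the mean of the Cauchy kernel. *)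
Lemma cauchy_formula f r z : 0 < r -> nrm z < r ->
  (forall z, nrm z < 2 * r -> exists l, cdiff f z l) ->
  mean (fun t => circ r t * f (circ r t) / (circ r t - z)) = f z.
Proof.
move=> r0 zr fd.
have [l fl] := fd z (lt_le_trans zr (ler_peMl (ltW r0) (ler1n _ 2))).
pose h w := if w == z then l else (f w - f z) / (w - z).
have hz : h z = l by rewrite /h eqxx.
have hw w : w != z -> h w = (f w - f z) / (w - z) by rewrite /h => /negbTE ->.
have hd w : nrm w < 2 * r -> w != z -> exists l, cdiff h w l.
  move=> w2 wz; have [m fm] := fd w w2; eexists.
  have wz' : 0 < nrm (w - z) by rewrite nrm_gt0 subr_eq0.
  apply: (tdiff_near (f := fun w => (f w - f z) * (w - z)^-1)).
    exists (nrm (w - z)) => // u uw; rewrite hw //.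
    by apply: contraTneq uw => ->; rewrite -leNgt nrmBC.
  apply: tdiffM; first exact: tdiffB fm (tdiff_cst _ _ _).
  apply: tdiffV; first by rewrite subr_eq0.
  exact: tdiffB (tdiff_id _ _) (tdiff_cst _ _ _).
have hc w : nrm w < 2 * r -> ccont h w.
  move=> w2; have [->|wz] := eqVneq w z; last first.
    by have [m hm] := hd w w2 wz; exact: tdiff_tcont hm.
  move=> e e0; have [d d0 H] := fl e e0; exists d => // u ud; rewrite hz.
  have [->|uz] := eqVneq u z; first by rewrite hz subrr nrm0 ltW.
  rewrite hw //.
  have uz' : 0 < nrm (u - z) by rewrite nrm_gt0 subr_eq0.
  rewrite -(ler_pM2r uz') -nrmM mulrBl divfK ?subr_eq0 //; exact: H.
have [||G HG] := @primitive_square _ h (6 / 5 * r) z (osq_nrm r0 (ltW zr)).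
- by move=> w /(csq_nrm r0); exact: hc.
- by move=> w /(csq_nrm r0); exact: hd.
have c2 t : nrm (circ r t) < 2 * r by rewrite nrm_circ ?(ltW r0) //; lra.
have cc t : rcont (circ r) t := rcont_circ r t.
have hcc t : rcont (fun t => h (circ r t)) t by apply: tcont_comp (hc _ (c2 t)) (cc t).
have fcc t : rcont (fun t => f (circ r t)) t.
  by have [m fm] := fd _ (c2 t); apply: tcont_comp (tdiff_tcont fm) (cc t).
have M0 : mean (fun t => h (circ r t) * ('i * circ r t)) = 0.
  apply: (mean_prim (G := fun t => G (circ r t))).
  - by move=> t; apply: tcontM (hcc t) (tcontM (tcont_cst _ _ _) (cc t)).
  - move=> t; apply: (tdiff_comp (f := G)) (rdiff_circ r t); apply: HG.
    by apply: osq_nrm; rewrite ?nrm_circ // ltW.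
  - by rewrite circ_per.
have kc t : rcont (fun t => circ r t / (circ r t - z)) t.
  apply: tcontM (cc t) _; apply: tcontV; first exact: circ_sub_neq0.
  exact: tcontB (cc t) (tcont_cst _ _ _).
have iN0 : 'i != 0 :> R[i] by rewrite -nrm_gt0 nrm_i.
have -> : (fun t => circ r t * f (circ r t) / (circ r t - z)) =
   (fun t => 'i^-1 * (h (circ r t) * ('i * circ r t)) + f z * (circ r t / (circ r t - z))).
  apply: funext => t; have c1 := circ_sub_neq0 t zr.
  rewrite hw; last by rewrite -subr_eq0.
  by field; rewrite c1 iN0.
rewrite meanD; first last.
- by move=> t; apply: tcontM (tcont_cst _ _ _) (kc t).
- move=> t; apply: tcontM (tcont_cst _ _ _) _.
  by apply: tcontM (hcc t) (tcontM (tcont_cst _ _ _) (cc t)).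
rewrite (meanZ 'i^-1); last by move=> t; apply: tcontM (hcc t) (tcontM (tcont_cst _ _ _) (cc t)).
by rewrite M0 mulr0 add0r meanZ // mean_cauchy_kernel // mulr1.
Qed.

(** The kernel zeta / (zeta - z) is expanded to third order; for [nrm z <= r / 2] the kernel in the
    remainder has modulus at most 2, whence the constant [2 * M / r ^+ 3]. *)
Lemma taylor2 f r M : 0 < r ->
  (forall z, nrm z < 2 * r -> exists l, cdiff f z l) ->
  (forall z, nrm z = r -> nrm (f z) <= M) ->
  exists a0 a1 a2 : R[i], [/\ nrm a0 <= M, nrm a1 <= M / r, nrm a2 <= M / r ^+ 2 &
    forall z, nrm z <= r / 2 ->
      nrm (f z - a0 - a1 * z - a2 * z ^+ 2) <= 2 * M / r ^+ 3 * nrm z ^+ 3].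
Proof.
move=> r0 fd fM.
have r0' := ltW r0.
have cc t : rcont (circ r) t := rcont_circ r t.
have c2 t : nrm (circ r t) < 2 * r by rewrite nrm_circ //; lra.
have fcc t : rcont (fun t => f (circ r t)) t.
  by have [m fm] := fd _ (c2 t); apply: tcont_comp (tdiff_tcont fm) (cc t).
have fcM t : nrm (f (circ r t)) <= M by apply: fM; rewrite nrm_circ.
have M0 : 0 <= M := le_trans (nrm_ge0 _) (fcM 0).
have uc t : rcont (fun t => (circ r t)^-1) t.
  by apply: tcontV (cc t); exact: circ_neq0.
have unc n t : rcont (fun t => (circ r t)^-1 ^+ n) t.
  elim: n => [|n IH]; first exact: tcont_cst.
  by apply: tcont_near (tcontM (uc t) IH); exists 1 => // s _; rewrite exprS.
pose g n t := f (circ r t) * (circ r t)^-1 ^+ n.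
have gc n t : rcont (g n) t by exact: tcontM (fcc t) (unc n t).
have gM n t : nrm (g n t) <= M / r ^+ n.
  rewrite nrmM nrmX nrmV nrm_circ // -exprVn ler_wpM2r //.
  by rewrite exprn_ge0 // invr_ge0.
have aM n : nrm (mean (g n)) <= M / r ^+ n by apply: mean_bound.
exists (mean (g 0)), (mean (g 1%N)), (mean (g 2)); split; [|exact: (aM 1%N)|exact: (aM 2)|].
  by have := aM 0%N; rewrite expr0 divr1.
move=> z zr; have zr' : nrm z < r by lra.
pose k t := g 3 t * (circ r t / (circ r t - z)).
have kc t : rcont k t.
  apply: tcontM (gc 3 t) _; apply: tcontM (cc t) _; apply: tcontV.
    exact: circ_sub_neq0.
  exact: tcontB (cc t) (tcont_cst _ _ _).
have kM t : nrm (k t) <= 2 * M / r ^+ 3.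
  rewrite nrmM (_ : 2 * M / r ^+ 3 = M / r ^+ 3 * 2); last by ring.
  rewrite ler_pM ?nrm_ge0 // nrmM nrmV nrm_circ // ler_pdivrMr ?nrm_gt0 ?circ_sub_neq0 //.
  by have := nrm_rev (circ r t) z; rewrite nrm_circ //; lra.
have Zc c (u : R -> R[i]) : (forall t, rcont u t) -> forall t, rcont (fun t => c * u t) t.
  by move=> H t; apply: tcontM (tcont_cst _ _ _) (H t).
have Dc (v u : R -> R[i]) : (forall t, rcont v t) -> (forall t, rcont u t) ->
    forall t, rcont (fun t => v t + u t) t.
  by move=> H H' t; apply: tcontD (H t) (H' t).
have -> : f z = mean (g 0%N) + (z * mean (g 1%N) + (z ^+ 2 * mean (g 2) + z ^+ 3 * mean k)).
  rewrite -(cauchy_formula r0 zr' fd) -!meanZ // -!meanD; try by auto 7.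
  congr mean; apply: funext => t; rewrite /k /g.
  have c0 := circ_neq0 t r0; have c1 := circ_sub_neq0 t zr'.
  by field; rewrite ?c0 ?c1.
have -> : mean (g 0%N) + (z * mean (g 1%N) + (z ^+ 2 * mean (g 2) + z ^+ 3 * mean k))
   - mean (g 0%N) - mean (g 1%N) * z - mean (g 2) * z ^+ 2 = mean k * z ^+ 3 by ring.
by rewrite nrmM nrmX ler_wpM2r ?exprn_ge0 ?nrm_ge0 // mean_bound.
Qed.

End Circle.

(** * Removable singularities and the Borel-Caratheodory bound *)

Section Holomorphic.
Variable R : realType.
Local Notation nrm := (@nrm R).
Implicit Types (f h : R[i] -> R[i]) (c z w : R[i]).

Definition hol f c (s : R) := forall z, nrm (z - c) < s -> exists l, cdiff f z l.

Lemma cdiff_uniq f z l m : cdiff f z l -> cdiff f z m -> l = m.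
Proof.
move=> fl fm; apply/eqP; rewrite -subr_eq0 -nrm_eq0 eq_le nrm_ge0 andbT.
apply/ler_addgt0Pr => e e0; rewrite add0r.
have e20 : 0 < e / 2 by rewrite divr_gt0.
have [d d0 H] := fl _ e20; have [d' d'0 H'] := fm _ e20.
pose r := Num.min d d' / 2.
have m0 : 0 < Num.min d d' by rewrite lt_min d0.
have r0 : 0 < r by rewrite divr_gt0.
have wr : nrm (z + r%:C - z) = r by rewrite addrC addKr nrm_real gtr0_norm.
have rd : r < Num.min d d' by rewrite /r; lra.
move: (rd); rewrite lt_min => /andP[rd1 rd2].
have := H (z + r%:C); have := H' (z + r%:C); rewrite wr => /(_ rd2) h2 /(_ rd1) h1.
rewrite -(ler_pM2r r0) -{1}wr -nrmM.
have -> : (l - m) * (z + r%:C - z) = (f (z + r%:C) - f z - m * (z + r%:C - z)) -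
  (f (z + r%:C) - f z - l * (z + r%:C - z)) by ring.
apply: (le_trans (nrmB _ _)); lra.
Qed.

Lemma cdiff_shift f c z l : cdiff f (c + z) l -> cdiff (fun w => f (c + w)) z l.
Proof.
move=> fl; apply: tdiff_eq (tdiff_comp fl (tdiffD (tdiff_cst _ c z) (tdiff_id _ z))) => //.
by rewrite add0r mulr1.
Qed.

(** Identifies the first two coefficients of [taylor2] by uniqueness of value and derivative. The
    first conclusion serves below as the mean value inequality, the second as Cauchy's estimate. *)
Lemma taylor_at f c r M : 0 < r -> hol f c (2 * r) ->
  (forall z, nrm (z - c) = r -> nrm (f z) <= M) ->
  nrm (f c) <= M /\ forall l, cdiff f c l -> nrm l <= M / r /\
  exists2 a : R[i], nrm a <= M / r ^+ 2 & forall z, nrm z <= r / 2 ->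
      nrm (f (c + z) - f c - l * z - a * z ^+ 2) <= 2 * M / r ^+ 3 * nrm z ^+ 3.
Proof.
move=> r0 fh fM.
have [||a0 [a1 [a2 [M0 M1 M2 T]]]] := @taylor2 _ (fun z => f (c + z)) r M r0.
- move=> z z2; have [|l fl] := fh (c + z); first by rewrite addrC addKr.
  by exists l; exact: cdiff_shift.
- by move=> z zr; apply: fM; rewrite addrC addKr.
have Mge0 : 0 <= M := le_trans (nrm_ge0 _) M0.
have E0 : f c = a0.
  have rr : 0 <= r / 2 by lra.
  have := T 0; rewrite nrm0 !expr0n /= !mulr0 addr0 !subr0 => /(_ rr) h; apply/eqP; rewrite -subr_eq0 -nrm_eq0 eq_le nrm_ge0.
  by rewrite andbT.
rewrite E0; split=> // l fl.
suff <- : a1 = l.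
  by split => //; exists a2 => // z; exact: T.
apply: (@cdiff_uniq (fun z => f (c + z)) 0); last by apply: cdiff_shift; rewrite addr0.
move=> e e0.
pose K := nrm a2 + 2 * M / r ^+ 3 * (r / 2) + 1.
have K1 : 0 <= 2 * M / r ^+ 3 by rewrite divr_ge0 ?exprn_ge0 ?mulr_ge0 // ltW.
have K0 : 0 < K.
  rewrite ltr_wpDl // addr_ge0 ?nrm_ge0 // mulr_ge0 // divr_ge0 // ltW //.
exists (Num.min (r / 2) (e / K)); first by rewrite lt_min !divr_gt0.
move=> z; rewrite subr0 lt_min /= => /andP[zr ze].
rewrite addr0 E0.
have -> : f (c + z) - a0 - a1 * z = (f (c + z) - a0 - a1 * z - a2 * z ^+ 2) + a2 * z ^+ 2 by ring.
apply: (le_trans (nrmD _ _)); rewrite nrmM nrmX.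
have := T z (ltW zr) => Tz; apply: (le_trans (lerD Tz (lexx _))).
have zK : nrm z * K <= e by rewrite -ler_pdivlMr // ltW.
have z0 := nrm_ge0 z.
apply: (@le_trans _ _ (nrm z * K * nrm z)); last by rewrite ler_wpM2r.
rewrite /K; have h : 2 * M / r ^+ 3 * nrm z <= 2 * M / r ^+ 3 * (r / 2).
  by rewrite ler_wpM2l // ltW.
have {}h := ler_wpM2r (mulr_ge0 z0 z0) h.
have := mulr_ge0 z0 z0; lra.
Qed.

Lemma hol_bounded f c s : 0 < s -> hol f c s ->
  exists2 r, 0 < r & [/\ 2 * r <= s & forall z, nrm (z - c) < 2 * r -> nrm (f z) <= nrm (f c) + 1].
Proof.
move=> s0 fh; have [|l fl] := fh c; first by rewrite subrr nrm0.
have [d d0 H] := tdiff_tcont fl ltr01.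
exists (Num.min s d / 2); first by rewrite divr_gt0 // lt_min s0.
have E : 2 * (Num.min s d / 2) = Num.min s d by field.
split; first by rewrite E ge_min lexx.
move=> z; rewrite E lt_min => /andP[_ /H]; have := nrm_rev (f z) (f c); lra.
Qed.

Definition dq f c l z := if z == c then l else (f z - f c) / (z - c).

Lemma dqE f c l z : f z = f c + (z - c) * dq f c l z.
Proof.
rewrite /dq; have [->|zc] := eqVneq z c; first by rewrite subrr mul0r addr0.
by rewrite mulrC divfK ?subr_eq0 // addrC subrK.
Qed.

Lemma dq_cdiff_out f c l z m : z != c -> cdiff f z m -> exists l', cdiff (dq f c l) z l'.
Proof.
move=> zc fm; eexists.
have zc' : 0 < nrm (z - c) by rewrite nrm_gt0 subr_eq0.
apply: (tdiff_near (f := fun w => (f w - f c) * (w - c)^-1)).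
  exists (nrm (z - c)) => // u uz; rewrite /dq ifF //.
  by apply/negbTE; apply: contraTneq uz => ->; rewrite -leNgt nrmBC.
apply: tdiffM; first exact: tdiffB fm (tdiff_cst _ _ _).
apply: tdiffV; first by rewrite subr_eq0.
exact: tdiffB (tdiff_id _ _) (tdiff_cst _ _ _).
Qed.

(** Removable singularity: dividing the cubic Taylor remainder by [z - c] leaves a quadratic error,
    so the second Taylor coefficient is the derivative of the quotient. *)
Lemma dq_cdiff f c l s : 0 < s -> hol f c s -> cdiff f c l -> exists l', cdiff (dq f c l) c l'.
Proof.
move=> s0 fh fl; have [r r0 [rs rM]] := hol_bounded s0 fh.
have [||_ /(_ l fl)[_ [a _ T]]] := @taylor_at f c r (nrm (f c) + 1) r0.
- by move=> z /lt_le_trans h; apply: fh; exact: h.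
- by move=> z zr; apply: rM; rewrite zr; lra.
set K := 2 * _ / _ in T.
have K0 : 0 <= K by rewrite divr_ge0 ?exprn_ge0 ?(ltW r0) // mulr_ge0 // addr_ge0 // nrm_ge0.
exists a => e e0; exists (Num.min (r / 2) (e / (K + 1))).
  by rewrite lt_min !divr_gt0 // ltr_wpDl.
move=> z; rewrite lt_min => /andP[zr ze]; rewrite /= in zr ze *.
rewrite [dq f c l c]/dq eqxx /dq; have [->|zc] := eqVneq z c.
  by rewrite !subrr mulr0 subrr nrm0 mulr0.
have z0 : 0 < nrm (z - c) by rewrite nrm_gt0 subr_eq0.
have := T (z - c) (ltW zr); rewrite (addrC c) subrK => Tz.
rewrite -(ler_pM2r z0) -nrmM.
have -> : ((f z - f c) / (z - c) - l - a * (z - c)) * (z - c) =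
   f z - f c - l * (z - c) - a * (z - c) ^+ 2 by field; rewrite subr_eq0.
apply: (le_trans Tz).
have zK : nrm (z - c) * (K + 1) <= e by rewrite -ler_pdivlMr ?ltr_wpDl // ltW.
have := ler_wpM2r (mulr_ge0 (ltW z0) (ltW z0)) zK.
have := mulr_ge0 (ltW z0) (mulr_ge0 (ltW z0) (ltW z0)).
rewrite exprS expr2; lra.
Qed.

Lemma cdiff_quad0 (a0 a1 a2 z : R[i]) :
  cdiff (fun z => a0 + a1 * z + a2 * z ^+ 2) z (a1 + 2 * a2 * z).
Proof.
apply: tdiff_eq (tdiffD (tdiffD (tdiff_cst _ a0 z) (tdiffZ a1 (tdiff_id _ z)))
   (tdiffZ a2 (tdiffX 2 (tdiff_id _ z)))) => //=.
by rewrite expr1; ring.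
Qed.

(* The second-order Taylor remainder [e] at [c] is [O(|z|^3)]; Cauchy's estimate on
   the circle of radius [|z|] around [z] makes its derivative [O(|z|^2)]. *)
Lemma deriv_cdiff f g c s : 0 < s -> (forall z, nrm (z - c) < s -> cdiff f z (g z)) ->
  exists l, cdiff g c l.
Proof.
move=> s0 fg; have fh : hol f c s by move=> z /fg; exists (g z).
have [r r0 [rs rM]] := hol_bounded s0 fh.
have fc : cdiff f c (g c) by apply: fg; rewrite subrr nrm0.
have [||_ /(_ (g c) fc)[_ [a _ T]]] := @taylor_at f c r (nrm (f c) + 1) r0.
- by move=> z /lt_le_trans h; apply: fh; exact: h.
- by move=> z zr; apply: rM; rewrite zr; lra.
set K := 2 * _ / _ in T.
have K0 : 0 <= K by rewrite divr_ge0 ?exprn_ge0 ?(ltW r0) // mulr_ge0 // addr_ge0 // nrm_ge0.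
pose e z := f (c + z) - (f c + g c * z + a * z ^+ 2).
have ed z : nrm z < s -> cdiff e z (g (c + z) - (g c + 2 * a * z)).
  move=> zs; apply: tdiffB (cdiff_quad0 _ _ _ _); apply: cdiff_shift.
  by apply: fg; rewrite addrC addKr.
have eT z : nrm z <= r / 2 -> nrm (e z) <= K * nrm z ^+ 3.
  move=> /T; rewrite /e !opprD !addrA.
  by [].
have key z : z != 0 -> nrm z <= r / 8 -> nrm (g (c + z) - g c - 2 * a * z) <= 8 * K * nrm z ^+ 2.
  move=> zn zr; have z0 : 0 < nrm z by rewrite nrm_gt0.
  have zs : nrm z < s by lra.
  have [||_ /(_ _ (ed z zs))[+ _]] := @taylor_at e z (nrm z) (K * (2 * nrm z) ^+ 3) z0.
  - move=> w wz; eexists; apply: ed; have := nrm_rev w z; lra.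
  - move=> w wz; have wr : nrm w <= 2 * nrm z by have := nrm_rev w z; lra.
    apply: (le_trans (eT w _)); first by lra.
    by rewrite ler_wpM2l // lerXn2r ?nnegrE ?nrm_ge0 ?mulr_ge0 // nrm_ge0.
  rewrite opprD addrA => /le_trans; apply.
  rewrite (_ : K * _ / _ = 8 * K * nrm z ^+ 2) //.
  by field; rewrite gt_eqF.
exists (2 * a) => d d0.
exists (Num.min (r / 8) (d / (8 * K + 1))).
  have : 0 < 8 * K + 1 by lra.
  by move=> h; rewrite lt_min !divr_gt0.
move=> w; rewrite lt_min /= => /andP[wr wd].
have [->|wc] := eqVneq w c; first by rewrite !subrr mulr0 subrr nrm0 mulr0.
have := key (w - c); rewrite subr_eq0 => /(_ wc (ltW wr)); rewrite (addrC c) subrK.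
move/le_trans; apply.
have h : 0 < 8 * K + 1 by lra.
have wK : nrm (w - c) * (8 * K + 1) <= d by rewrite -ler_pdivlMr // ltW.
have w0 := nrm_ge0 (w - c).
apply: (@le_trans _ _ (nrm (w - c) * (8 * K + 1) * nrm (w - c))); last by rewrite ler_wpM2r.
have := mulr_ge0 w0 w0; rewrite expr2; lra.
Qed.

(* The half-plane [Re w <= A] is sent into the unit disk by [w |-> w / (2A - w)]. *)
Lemma borel_caratheodory G rho A l : 0 < rho -> 0 < A -> hol G 0 rho -> G 0 = 0 ->
  cdiff G 0 l -> (forall z, nrm z < rho -> complex.Re (G z) <= A) ->
  forall z, nrm z <= rho / 64 -> nrm (G z - l * z) <= 64 * 64 * A * nrm z ^+ 2 / rho ^+ 2.
Proof.
move=> rho0 A0 Gh G0 Gl GA.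
have D0 z : nrm z < rho -> 2 * A%:C - G z != 0.
  move=> zr; apply: contraTneq (GA z zr) => h; rewrite -ltNge.
  have := congr1 (@complex.Re R) h; rewrite !cE /= => h'; lra.
have DG z : nrm z < rho -> nrm (G z) <= nrm (2 * A%:C - G z).
  move=> zr; rewrite -(@ler_pXn2r _ 2) ?nnegrE ?nrm_ge0 // !nrm_sqr !cE /=.
  have := GA z zr; nra.
pose phi z := G z * (2 * A%:C - G z)^-1.
have phi0 : phi 0 = 0 by rewrite /phi G0 mul0r.
have phid z : nrm z < rho -> exists l, cdiff phi z l.
  move=> zr; have [|m Gm] := Gh z; first by rewrite subr0.
  eexists; apply: tdiffM (Gm) _; apply: tdiffV; first exact: D0.
  exact: tdiffB (tdiff_cst _ _ _) Gm.
have phi1 z : nrm z < rho -> nrm (phi z) <= 1.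
  move=> zr; rewrite nrmM nrmV ler_pdivrMr ?nrm_gt0 ?D0 // mul1r; exact: DG.
have rho1 : nrm 0 < rho by rewrite nrm0.
have [m phim] := phid 0 rho1.
pose psi := dq phi 0 m.
have psih z : nrm z < rho -> exists l, cdiff psi z l.
  move=> zr; have [->|z0] := eqVneq z 0.
    by apply: dq_cdiff phim; [exact: rho0|move=> w; rewrite subr0; exact: phid].
  have [n phin] := phid z zr; exact: dq_cdiff_out phin.
have psiE z : phi z = z * psi z by rewrite {1}(dqE phi 0 m) phi0 add0r subr0.
(* Schwarz's lemma up to a constant: on the circle of radius [rho / 4] around [z] one has
   [nrm w >= rho / 8] and [phi] is bounded by 1, so the mean value inequality bounds [psi] by
   [8 / rho]. *)
have psiM z : nrm z <= rho / 16 -> nrm (psi z) <= 8 / rho.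
  move=> zr; have [|||h _] := @taylor_at psi z (rho / 4) (8 / rho); [by rewrite divr_gt0| | |exact: h].
  - move=> w wz; apply: psih; have := nrm_rev w z; lra.
  - move=> w wz.
    have w1 : rho / 8 <= nrm w by have := nrm_rev (w - z) (- z); rewrite opprK subrK nrmN; lra.
    have w2 : nrm w < rho by have := nrm_rev w z; lra.
    have w0 : 0 < nrm w by lra.
    have := phi1 w w2; rewrite psiE nrmM => h.
    rewrite ler_pdivlMr // ; have := nrm_ge0 (psi w); nra.
have G2A z : nrm z <= rho / 16 -> nrm (G z) <= 2 * A.
  move=> zr; have zr' : nrm z < rho by lra.
  have p2 : nrm (phi z) <= 1 / 2.
    rewrite psiE nrmM; have h1 := psiM z zr.
    have -> : 1 / 2 = rho / 16 * (8 / rho) by field; rewrite gt_eqF.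
    by rewrite ler_pM ?nrm_ge0.
  (* Solving the definition of [phi] for [G]: since [phi] has modulus at most 1/2 here, [nrm (G z)]
     is at most [A] plus half of itself. *)
  have E : G z = phi z * (2 * A%:C) - phi z * G z.
    by rewrite -mulrBr /phi divfK // D0.
  have := nrmB (phi z * (2 * A%:C)) (phi z * G z); rewrite -E !(nrmM (phi z)) (nrmM 2) nrm_real (gtr0_norm A0).
  have -> : nrm 2 = 2 by rewrite -(rmorph_nat (real_complex R)) nrm_real ger0_norm.
  have := ler_wpM2r (nrm_ge0 (G z)) p2; have := ler_wpM2r (ltW A0) p2.
  by lra.
(* With radius [rho / 32] and bound [2 * A], the quadratic term and the cubic remainder each
   contribute at most 2048 * A * |z|^2 / rho^2; this gives the constant 64 * 64. *)
have [|||_ /(_ l Gl)[_ [a aM T]]] := @taylor_at G 0 (rho / 32) (2 * A).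
- by rewrite divr_gt0.
- by move=> z; rewrite subr0 => zr; apply: Gh; rewrite subr0; lra.
- by move=> z; rewrite subr0 => zr; apply: G2A; lra.
move=> z zr; have z0 := nrm_ge0 z.
have zr' : nrm z <= rho / 32 / 2 by lra.
have := T z zr'; rewrite add0r G0 subr0 => Tz.
have -> : G z - l * z = (G z - l * z - a * z ^+ 2) + a * z ^+ 2 by ring.
apply: (le_trans (nrmD _ _)); rewrite nrmM nrmX.
have aM' := ler_wpM2r (exprn_ge0 2 z0) aM.
apply: (le_trans (lerD Tz aM')).
have -> : 64 * 64 * A * nrm z ^+ 2 / rho ^+ 2 =
  2 * (2 * A) / (rho / 32) ^+ 3 * (nrm z ^+ 2 * (rho / 64)) + 2 * A / (rho / 32) ^+ 2 * nrm z ^+ 2.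
  by field; rewrite gt_eqF.
rewrite lerD2r ler_wpM2l //.
  by rewrite divr_ge0 ?exprn_ge0 ?mulr_ge0 // ltW ?divr_gt0.
by rewrite exprSr ler_wpM2l // exprn_ge0.
Qed.

End Holomorphic.

(** * Factoring out zeros *)

Section Factor.
Variable R : realType.
Local Notation nrm := (@nrm R).
Implicit Types (f h : R[i] -> R[i]) (c z w : R[i]) (s : seq R[i]).

(** Compactness by the bisection used for Goursat's theorem, a rectangle now being bad when [h] is
    unbounded on it. *)
Lemma bounded_square h (s : R) : 0 <= s -> (forall z, ccont h z) ->
  exists M, forall z, csq s z -> nrm (h z) <= M.
Proof.
move=> s0 hc.
pose inr (x y k : R) (z : R[i]) := [/\ x <= complex.Re z, complex.Re z <= x + k * (2 * s),
    y <= complex.Im z & complex.Im z <= y + k * (2 * s)].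
pose B x y k := forall M, exists2 z, inr x y k z & M < nrm (h z).
have s20 : 0 <= 2 * s by lra.
have NB : ~ B (- s) (- s) 1.
  apply: (@rect_bisect _ B (- s) (- s) (2 * s) (2 * s)) => //; last first.
    move=> cx cy _ _; have [d d0 H] := hc (cx +i* cy) _ ltr01.
    have s1 : 0 < 4 * s + 1 by lra.
    exists (d / (4 * s + 1)); first by rewrite divr_gt0.
    move=> x y k /andP[k0 kd] _ /andP[x1 x2] _ _ /andP[y1 y2] _.
    move=> /(_ (nrm (h (cx +i* cy)) + 1))[z [h1 h2 h3 h4]].
    apply/negP; rewrite -leNgt.
    have kd' : k * (4 * s + 1) < d by rewrite -ltr_pdivlMr.
    have := H z; have := nrm_leD (z - (cx +i* cy)); rewrite !cE /= => a1.
    have a2 : `|complex.Re z - cx| <= k * (2 * s) by rewrite ler_norml; lra.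
    have a3 : `|complex.Im z - cy| <= k * (2 * s) by rewrite ler_norml; lra.
    have a4 : nrm (z - (cx +i* cy)) < d by lra.
    move=> /(_ a4); have := nrm_rev (h z) (h (cx +i* cy)); lra.
  move=> x y k k0 Bk; apply: contrapT => nB.
  have nb p1 p2 : (p1 = x \/ p1 = x + k / 2 * (2 * s)) ->
      (p2 = y \/ p2 = y + k / 2 * (2 * s)) ->
      exists M, forall z, inr p1 p2 (k / 2) z -> nrm (h z) <= M.
    move=> h1 h2; apply: contrapT => nM; apply: nB; exists (p1, p2) => //= M.
    apply: contrapT => nz; apply: nM; exists M => z zin; rewrite leNgt; apply/negP => zM.
    by apply: nz; exists z.
  have [M1 H1] := nb x y (or_introl erefl) (or_introl erefl).
  have [M2 H2] := nb _ y (or_intror erefl) (or_introl erefl).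
  have [M3 H3] := nb x _ (or_introl erefl) (or_intror erefl).
  have [M4 H4] := nb _ _ (or_intror erefl) (or_intror erefl).
  have [z [z1 z2 z3 z4]] := Bk (Num.max (Num.max M1 M2) (Num.max M3 M4)).
  apply/negP; rewrite -leNgt !le_max.
  have Ek : k * (2 * s) = k / 2 * (2 * s) + k / 2 * (2 * s) by field.
  rewrite Ek in z2 z4.
  have [zx|/ltW zx] := leP (complex.Re z) (x + k / 2 * (2 * s));
  have [zy|/ltW zy] := leP (complex.Im z) (y + k / 2 * (2 * s)).
  - by rewrite H1.
  - by rewrite H3 ?orbT //; split=> //; rewrite -addrA.
  - by rewrite H2 ?orbT //; split=> //; rewrite -addrA.
  - by rewrite H4 ?orbT //; split=> //; rewrite -addrA.
apply: contrapT => nM; apply: NB => M; apply: contrapT => nz; apply: nM; exists M => z [z1 z2].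
rewrite leNgt; apply/negP => zM; apply: nz; exists z => //.
by move: z1 z2; rewrite !ler_norml => /andP[? ?] /andP[? ?]; split; lra.
Qed.

Definition centire f := forall z, exists l, cdiff f z l.

Lemma centire_bounded f (r : R) : 0 <= r -> centire f ->
  exists M, forall z, nrm z <= r -> nrm (f z) <= M.
Proof.
move=> r0 fe; have [|M HM] := @bounded_square f r r0.
  by move=> z; have [l fl] := fe z; exact: tdiff_tcont fl.
exists M => z zr; apply: HM; have := Re_le_nrm z; have := Im_le_nrm z.
by split; lra.
Qed.

Lemma factor_zero f a : centire f -> a != 0 -> f a = 0 ->
  exists2 F, centire F & forall z, f z = (1 - z / a) * F z.
Proof.
move=> fe a0 fa; have [l fl] := fe a.
exists (fun z => - a * dq f a l z).
  move=> z; have [m dm] : exists m, cdiff (dq f a l) z m.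
    have [->|za] := eqVneq z a; first by apply: (dq_cdiff ltr01) fl => w _.
    by have [m fm] := fe z; exact: dq_cdiff_out fm.
  by exists (- a * m); exact: tdiffZ.
move=> z; rewrite (dqE f a l z) fa; field; exact: a0.
Qed.

(** The factors equal 1 at 0, so dividing by them preserves the value at 0; multiple zeros are
    repeated in the list. *)
Definition zprod s z := \prod_(a <- s) (1 - z / a).

Lemma zprod_cons a s z : zprod (a :: s) z = (1 - z / a) * zprod s z.
Proof. by rewrite /zprod big_cons. Qed.

Lemma zprod0 s : zprod s 0 = 1.
Proof. by rewrite /zprod big1 // => a _; rewrite mul0r subr0. Qed.

Lemma zprod_diff0 s : cdiff (zprod s) 0 (- \sum_(a <- s) a^-1).
Proof.
elim: s => [|a s IH].
  by apply: tdiff_eq (tdiff_cst _ 1 0) => [z|]; rewrite /zprod ?big_nil ?oppr0.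
apply: tdiff_eq (tdiffM (tdiffB (tdiff_cst _ 1 0) (tdiffZ a^-1 (tdiff_id _ 0))) IH) => [z|].
  by rewrite zprod_cons mulrC [a^-1 * _]mulrC [RHS]mulrC.
by rewrite zprod0 big_cons; ring.
Qed.

Lemma zprod_ge s z (q : R) : 0 <= q ->
  (forall a, a \in s -> q <= nrm (1 - z / a)) -> q ^+ size s <= nrm (zprod s z).
Proof.
move=> q0; elim: s => [|a s IH] H; first by rewrite /zprod big_nil nrm1.
rewrite zprod_cons nrmM exprS ler_pM ?exprn_ge0 //; first by rewrite H ?mem_head.
by apply: IH => b bs; rewrite H // inE bs orbT.
Qed.

(** Used with [q = 2] on the circle of radius 3r, to count zeros, and with [q = 1] beyond radius 2r,
    where the product has modulus at least 1. *)
Lemma nrm_1div z a (q r : R) : a != 0 -> nrm a <= r -> (q + 1) * r <= nrm z -> 0 <= q ->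
  q <= nrm (1 - z / a).
Proof.
move=> a0 ar zr q0; have an : 0 < nrm a by rewrite nrm_gt0.
have := nrm_rev (z / a) 1; rewrite nrmBC nrm1 nrmM nrmV.
suff : q + 1 <= nrm z / nrm a by lra.
rewrite ler_pdivlMr // (le_trans _ zr) // ler_wpM2l //; lra.
Qed.

(* The process of factoring out zeros stops: with [k] zeros in the disk of radius [r],
   the mean value inequality on the circle of radius [3r] gives
   [2^k |f 0| <= max_(|z| <= 3r) |f z|]. *)
Lemma factorization f (r : R) : 0 < r -> centire f -> f 0 != 0 ->
  exists s F, [/\ centire F, (forall z, f z = zprod s z * F z),
    (forall a, a \in s -> [/\ a != 0, nrm a < r & f a = 0]) &
    (forall z, nrm z < r -> F z != 0)].
Proof.
move=> r0 fe f0.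
have [|M HM] := @centire_bounded f (3 * r) _ fe; first by lra.
pose P s F := [/\ centire F, (forall z, f z = zprod s z * F z) &
    (forall a, a \in s -> [/\ a != 0, nrm a < r & f a = 0])].
have size_bd s F : P s F -> 2 ^+ size s * nrm (f 0) <= M.
  move=> [Fe fF Hs].
  have F0 : F 0 = f 0 by rewrite fF zprod0 mul1r.
  have [|||+ _] := @taylor_at _ F 0 (3 * r) (M / 2 ^+ size s).
  - by lra.
  - by move=> z _; exact: Fe.
  - move=> z; rewrite subr0 => zr; rewrite ler_pdivlMr ?exprn_gt0 // mulrC.
    have := HM z; rewrite zr lexx fF nrmM => /(_ isT); apply: le_trans.
    rewrite ler_wpM2r ?nrm_ge0 //; apply: zprod_ge => // a /Hs[a0 ar _].
    apply: (nrm_1div a0 (ltW ar)) => //; rewrite zr; lra.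
  by rewrite F0 ler_pdivlMr ?exprn_gt0 // mulrC.
apply: contrapT => Hno.
(* If every cofactor still had a zero in the disk, zeros could be extracted forever, against the
   bound on the length of the list. *)
have step n : exists s F, size s = n /\ P s F.
  elim: n => [|n [s [F [sn [Fe fF Hs]]]]].
    exists [::], f; split => //; split => // z; by rewrite /zprod big_nil mul1r.
  have [a [ar Fa]] : exists a, nrm a < r /\ F a = 0.
    apply: contrapT => nz; apply: Hno; exists s, F; split => // z zr.
    by apply/negP => /eqP Fz; apply: nz; exists z.
  have fa : f a = 0 by rewrite fF Fa mulr0.
  have a0 : a != 0 by apply: contra_neq f0 => Ea; move: fa; rewrite Ea.
  have [G Ge FG] := factor_zero Fe a0 Fa.
  exists (a :: s), G; split; first by rewrite /= sn.
  split => // [z|b]; first by rewrite fF FG zprod_cons; ring.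
  by rewrite inE => /predU1P[->//|/Hs].
pose n := (Num.truncn (M / nrm (f 0))).+1.
have [s [F [sn Ps]]] := step n; have := size_bd s F Ps; rewrite sn.
have f0' : 0 < nrm (f 0) by rewrite nrm_gt0.
rewrite -ler_pdivlMr // => h.
have : M / nrm (f 0) < 2 ^+ n.
  by rewrite (lt_le_trans (truncnS_gt _)) // -natrX ler_nat ltnW // ltn_expl.
by rewrite ltNge h.
Qed.

Lemma rdiff_conj (g : R -> R[i]) t l : rdiff g t l ->
  rdiff (fun u => (g u)^*) t l^*.
Proof.
move=> gl e e0; have [d d0 H] := gl e e0; exists d => // u /H; apply: le_trans.
rewrite le_eqVlt; apply/orP; left; apply/eqP.
have -> : (g u)^* - (g t)^* - l^* * (real_complex R u - real_complex R t) =
   (g u - g t - l * (real_complex R u - real_complex R t))^*.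
  by apply: c_eq; case: (g u) (g t) (l) => [? ?] [? ?] [? ?]; rewrite !cE /=; ring.
by case: (_ - _ - _) => a b; rewrite !nrmE /= sqrrN.
Qed.

Lemma mulcJE (z : R[i]) : z * z^* = (nrm z ^+ 2)%:C.
Proof.
by rewrite nrm_sqr; apply: c_eq; case: z => a b; rewrite !cE /=; ring.
Qed.

(** [G] is a primitive of F'/F vanishing at 0. Only its real part is wanted, so no complex
    exponential occurs: |F|^2 exp(-2 Re G) has null derivative along the segment from 0 to [z]. *)
Lemma zero_free_log F (r : R) : 0 < r -> centire F ->
  (forall z, nrm z < 2 * r -> F z != 0) ->
  exists G, [/\ hol G 0 r, G 0 = 0,
    (forall l, cdiff F 0 l -> cdiff G 0 (l / F 0)) &
    (forall z, nrm z < r -> complex.Re (G z) = ln (nrm (F z)) - ln (nrm (F 0)))].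
Proof.
move=> r0 Fe F0.
have /choice[dF HdF] := Fe.
pose L z := dF z / F z.
have Ld z : nrm z < 2 * r -> exists l, cdiff L z l.
  move=> zr; have [|m dm] := @deriv_cdiff _ F dF z 1 ltr01; first by move=> w _; exact: HdF.
  by eexists; apply: tdiffM dm _; apply: tdiffV; [exact: F0|exact: HdF].
have [|||G1 HG1] := @primitive_square _ L (6 / 5 * r) 0.
- by split; rewrite normr0; lra.
- by move=> z /(csq_nrm r0)/Ld[l Ll]; exact: tdiff_tcont Ll.
- by move=> z /(csq_nrm r0)/Ld.
pose G z := G1 z - G1 0.
have GL z : nrm z < r -> cdiff G z (L z).
  move=> zr; apply: tdiff_eq (tdiffB (HG1 z (osq_nrm r0 (ltW zr))) (tdiff_cst _ (G1 0) z)) => //.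
  by rewrite subr0.
exists G; split; first by move=> z; rewrite subr0 => /GL; exists (L z).
- by rewrite /G subrr.
- move=> l Fl; rewrite (cdiff_uniq Fl (HdF 0)); apply: GL; by rewrite nrm0.
move=> z zr.
pose p (t : R) : R[i] := z * t%:C.
have pd t : rdiff p t z by apply: tdiff_eq (tdiffZ z (rdiff_id t)); rewrite ?mulr1.
have pr t : 0 <= t <= 1 -> nrm (p t) < r.
  move=> /andP[t0 t1]; rewrite nrmM nrm_real ger0_norm //; have := nrm_ge0 z; nra.
pose A t := F (p t); pose E t := expR (- 2 * complex.Re (G (p t))).
have Ad t : rdiff A t (dF (p t) * z) by apply: tdiff_comp (HdF _) (pd t).
pose Q t := A t * (A t)^* * (E t)%:C.
have Qd t : 0 <= t <= 1 -> rdiff Q t 0.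
  move=> /pr tr.
  have Bd : rdiff (fun t => G (p t)) t (L (p t) * z) by apply: tdiff_comp (GL _ tr) (pd t).
  have Ed : rdiff (fun t => (E t)%:C) t (E t * (- 2 * complex.Re (L (p t) * z)))%:C.
    apply: rdiff_real.
    have h : is_derive t 1 (fun t => - 2 * complex.Re (G (p t))) (- 2 * complex.Re (L (p t) * z)).
      have Ef (u : R[i]) : complex.Re ((- 2)%:C * u) = - 2 * complex.Re u.
        by rewrite cRe_M /= mul0r subr0.
      rewrite -Ef (_ : (fun t => _) = (fun t => complex.Re ((- 2)%:C * G (p t)))).
        exact: rdiff_Re (tdiffZ (- 2)%:C Bd).
      by apply: funext => u; rewrite Ef.
    exact: (is_derive1_comp (is_derive_expR _) h).
  apply: tdiff_eq (tdiffM (tdiffM (Ad t) (rdiff_conj (Ad t))) Ed) => //.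
  have At0 : A t != 0 by apply: F0; lra.
  have EA : dF (p t) * z = A t * (L (p t) * z) by rewrite /L /A; field.
  rewrite EA; move: (L (p t) * z) (A t) (E t) => u a e.
  by apply: c_eq; case: u a => [? ?] [? ?]; rewrite !cE /=; ring.
have := rdiff0_cst ler01 Qd; rewrite /Q /A /p mulr1 mulr0 /E /p mulr1 mulr0.
have -> : G 0 = 0 by rewrite /G subrr.
rewrite mulr0 expR0 mulr1 !mulcJE -rmorphM => /complexI H.
have F0' : 0 < nrm (F 0) by rewrite nrm_gt0 F0 // nrm0; lra.
have Fz' : 0 < nrm (F z) by rewrite nrm_gt0 F0 //; lra.
have := congr1 (@ln R) H; rewrite lnM ?posrE ?exprn_gt0 ?expR_gt0 // expRK !lnXn //.
lra.
Qed.

End Factor.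

(** * Approximation by finite products *)

Section Hadamard.
Variable R : realType.
Local Notation nrm := (@nrm R).
Implicit Types (f h : R[i] -> R[i]) (c z w : R[i]) (s : seq R[i]).

Lemma Re_inv_imag (a : R[i]) : complex.Re a = 0 -> complex.Re a^-1 = 0.
Proof. by case: a => x y /= ->; rewrite mul0r. Qed.

Lemma nrm_1div_imag (a : R[i]) (x : R) : complex.Re a = 0 ->
  nrm (1 - x%:C / a) ^+ 2 = 1 + nrm a ^- 2 * x ^+ 2.
Proof.
move=> Ra; have Rv := Re_inv_imag Ra.
have -> : nrm a ^- 2 = complex.Im a^-1 ^+ 2.
  by rewrite -exprVn -nrmV nrm_sqr Rv expr0n add0r.
by rewrite nrm_sqr !cE Rv /=; ring.
Qed.

Lemma ln_nrm_zprod s (x : R) : (forall a, a \in s -> complex.Re a = 0) ->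
  0 < nrm (zprod s x%:C) /\
  ln (nrm (zprod s x%:C)) = 2^-1 * \sum_(a <- s) ln (1 + nrm a ^- 2 * x ^+ 2).
Proof.
elim: s => [|a s IH] H; first by rewrite /zprod !big_nil nrm1 ln1 mulr0.
have [|P0 E] := IH; first by move=> b bs; apply: H; rewrite inE bs orbT.
have Ra : complex.Re a = 0 by apply: H; exact: mem_head.
have a1 : 0 < 1 + nrm a ^- 2 * x ^+ 2.
  by rewrite ltr_wpDr // mulr_ge0 ?sqr_ge0 // invr_ge0 sqr_ge0.
have n0 : 0 < nrm (1 - x%:C / a).
  rewrite lt_def nrm_ge0 andbT; apply: contraTneq a1 => h.
  by rewrite -(nrm_1div_imag x Ra) h expr0n ltxx.
rewrite zprod_cons nrmM mulr_gt0 // lnM ?posrE // E big_cons mulrDr; split => //.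
by rewrite -(nrm_1div_imag x Ra) lnXn // -[ln _ *+ 2]mulr_natl mulKf ?pnatr_eq0.
Qed.

(** The growth needed below: [eta] is arbitrary, but arbitrarily large radii suffice. The annulus
    contains every circle of radius 3r whose centre has modulus less than r/2. *)
Definition subquadratic f := forall eta r0 : R, 0 < eta -> exists2 r, r0 <= r &
  forall z, 2 * r <= nrm z <= 4 * r -> nrm (f z) <= expR (eta * r ^+ 2).

Lemma hadamard f : centire f -> f 0 != 0 -> cdiff f 0 0 ->
  (forall z, f z = 0 -> complex.Re z = 0) -> subquadratic f ->
  forall X e : R, 0 < e -> exists2 ts : seq R, (forall t, t \in ts -> 0 <= t) &
  forall x, 0 <= x <= X ->
    `|ln (nrm (f x%:C)) - ln (nrm (f 0)) - 2^-1 * \sum_(t <- ts) ln (1 + t * x ^+ 2)| <= e.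
Proof.
move=> fe f0 df0 fz fgr X e e0.
have [X0|X0] := ltP X 0.
  by exists [::] => // x /andP[x0 xX]; have := lt_le_trans X0 (le_trans x0 xX); rewrite ltxx.
set L := `|ln (nrm (f 0))| + 1.
have L0 : 0 < L by rewrite ltr_wpDl.
have XX : 0 <= X ^+ 2 by rewrite sqr_ge0.
(* 64 * 64 from the Borel-Caratheodory bound, times 4 because it is applied with radius [r / 2]; the
   literal is kept abstract. *)
have [K K0 EK] : exists2 K : R, 0 < K & forall y, K * y = 16 * 16 * 64 * y.
  by exists (16 * 16 * 64); [rewrite !mulr_gt0|].
pose eta := e / (2 * K * (X ^+ 2 + 1)).
have D0 : 0 < 2 * K * (X ^+ 2 + 1) by rewrite !mulr_gt0 // ltr_wpDl.
have eta0 : 0 < eta by rewrite divr_gt0.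
(* The second term puts [0, X] inside 1/64 of the radius [r / 2]; the third makes the contribution
   of the constant [L] at most e/2, while [eta] takes care of the other half. *)
pose r0 := 1 + 128 * X + 2 * K * X ^+ 2 * L / e.
have r00 : 0 <= 2 * K * X ^+ 2 * L / e by rewrite divr_ge0 ?mulr_ge0 // ltW.
have [r rr Hr] := fgr eta r0 eta0.
have r1 : 1 <= r by apply: le_trans rr; rewrite /r0; lra.
have rX : X <= r / 128 by have := rr; rewrite /r0; lra.
have rL : K * X ^+ 2 * L <= e / 2 * r.
  have : 2 * K * X ^+ 2 * L / e <= r by have := rr; rewrite /r0; lra.
  by rewrite ler_pdivrMr //; lra.
have rp : 0 < r by lra.
have [s [F [Fe fF Hs HF]]] := factorization rp fe f0.
have F0 : F 0 = f 0 by rewrite fF zprod0 mul1r.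
have r2 : 0 < r / 2 by lra.
have [|G [Gh G0 Gd GR]] := zero_free_log r2 Fe.
  by move=> z zr; apply: HF; lra.
have [m Fm] := Fe 0.
pose l := m / F 0.
have Gl : cdiff G 0 l := Gd m Fm.
have FN0 : F 0 != 0 by rewrite F0.
(* Differentiating f = P F at 0, where f' vanishes, expresses F'(0) / F(0) through the zeros
   alone. *)
have El : l = \sum_(a <- s) a^-1.
  have h : cdiff f 0 (- (\sum_(a <- s) a^-1) * F 0 + zprod s 0 * m).
    by apply: tdiff_eq (tdiffM (zprod_diff0 s) Fm).
  have := cdiff_uniq df0 h; rewrite zprod0 mul1r => /eqP.
  rewrite eq_sym addrC mulNr subr_eq0 => /eqP Em.
  by rewrite /l Em mulfK.
have Rl : complex.Re l = 0.
  rewrite El raddf_sum big1_seq // => a /andP[_ /Hs[_ _ fa]].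
  exact: Re_inv_imag (fz _ fa).
pose A := eta * r ^+ 2 + L.
have A0 : 0 < A by rewrite addr_gt0 // mulr_gt0 // exprn_gt0.
have GA z : nrm z < r / 2 -> complex.Re (G z) <= A.
  move=> zr; rewrite GR // F0.
  (* Mean value inequality on the circle of radius 3r around [z]: its points have modulus between
     5r/2 and 7r/2, where the product has modulus at least 1 and so |F| <= |f|. *)
  have nF : nrm (F z) <= expR (eta * r ^+ 2).
    have [|||h _] := @taylor_at _ F z (3 * r) (expR (eta * r ^+ 2)); [lra| | |exact: h].
    - by move=> w _; exact: Fe.
    - move=> w wz.
      have w1 : 5 / 2 * r <= nrm w by have := nrm_rev (w - z) (- z); rewrite opprK subrK nrmN; lra.
      have w2 : nrm w <= 7 / 2 * r by have := nrm_rev w z; lra.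
      apply: le_trans (Hr w _); last by apply/andP; split; lra.
      rewrite fF nrmM ler_peMl ?nrm_ge0 //.
      have := @zprod_ge _ s w 1 ler01; rewrite expr1n; apply => a /Hs[a0 ar _].
      by apply: (nrm_1div a0 (ltW ar)) => //; lra.
  have Fz0 : 0 < nrm (F z) by rewrite nrm_gt0 HF //; lra.
  have : ln (nrm (F z)) <= eta * r ^+ 2.
    by rewrite -[X in _ <= X]expRK ler_ln ?posrE ?expR_gt0.
  have := ler_norm (- ln (nrm (f 0))); rewrite normrN /A /L; lra.
have BC := borel_caratheodory r2 A0 Gh G0 Gl GA.
exists [seq nrm a ^- 2 | a <- s].
  by move=> t /mapP[a _ ->]; rewrite invr_ge0 sqr_ge0.
move=> x /andP[x0 xX]; rewrite big_map.
have [|P0 EP] := @ln_nrm_zprod s x; first by move=> a /Hs[_ _ /fz].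
have nx : nrm x%:C = x by rewrite nrm_real ger0_norm.
have Fx0 : 0 < nrm (F x%:C) by rewrite nrm_gt0 HF // nx; lra.
have -> : ln (nrm (f x%:C)) - ln (nrm (f 0)) - 2^-1 * \sum_(a <- s) ln (1 + nrm a ^- 2 * x ^+ 2)
   = complex.Re (G x%:C - l * x%:C).
  rewrite cRe_D cRe_N cRe_M Rl /= mul0r mulr0 !subr0 GR ?nx; last by lra.
  by rewrite -EP F0 (fF x%:C) nrmM lnM ?posrE //; lra.
apply: (le_trans (Re_le_nrm _)); apply: (le_trans (BC _ _)); rewrite nx; first by lra.
have -> : 64 * 64 * A * x ^+ 2 / (r / 2) ^+ 2 = K * A * x ^+ 2 / r ^+ 2.
  by rewrite -!mulrA EK; field; rewrite gt_eqF.
rewrite ler_pdivrMr ?exprn_gt0 //.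
have x2 : x ^+ 2 <= X ^+ 2 by rewrite lerXn2r ?nnegrE // (le_trans x0).
apply: (@le_trans _ _ (K * A * X ^+ 2)).
  by rewrite ler_wpM2l // mulr_ge0 // ltW.
have h1 : K * X ^+ 2 * eta <= e / 2.
  rewrite /eta mulrA ler_pdivrMr //.
  have -> : e / 2 * (2 * K * (X ^+ 2 + 1)) = K * X ^+ 2 * e + K * e by field.
  by rewrite lerDl ltW // mulr_gt0.
have h2 : e / 2 * r <= e / 2 * r ^+ 2.
  by rewrite ler_wpM2l ?(ltW (divr_gt0 e0 _)) // expr2 ler_peMr // ltW.
have -> : K * A * X ^+ 2 = K * X ^+ 2 * eta * r ^+ 2 + K * X ^+ 2 * L by rewrite /A; ring.
have := ler_wpM2r (sqr_ge0 r) h1; lra.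
Qed.

End Hadamard.

(** * From the growth order to the subquadratic bound *)

Section Growth.
Variable R : realType.
Local Notation nrm := (@nrm R).
Implicit Types (f : R[i] -> R[i]) (z : R[i]).

Lemma entire_centire f : entire f -> centire f.
Proof. by move=> fe z; exact: entire_cdiff (fe z). Qed.

Lemma derive1_cdiff f : entire f -> derive1 (f : R[i] -> R[i]^o) 0 = 0 -> cdiff f 0 0.
Proof.
move=> fe; rewrite derive1E => f0; apply: cdiff_is_derive.
by have := derivableP (fe 0); rewrite f0.
Qed.

Lemma max_modulus_ge f z : centire f -> nrm (f z) <= max_modulus f (nrm z).
Proof.
move=> fe; have [M HM] := centire_bounded (nrm_ge0 z) fe.
apply: ub_le_sup; last first.
  by exists z; [rewrite /= normE|rewrite normE].
exists M => _ [w wz <-]; rewrite normE /=; apply: HM.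
have : `|w| = (nrm z)%:C := wz.
by rewrite normE => /complexI ->.
Qed.

Lemma growth_order_bound f : centire f -> (growth_order f < 2%:E)%E ->
  exists2 tau : R, 0 <= tau < 2 & exists r0 : R, forall z, r0 <= nrm z ->
    nrm (f z) <= expR (expR (tau * ln (nrm z))).
Proof.
move=> fe /ereal_inf_lt[_ [V [M [_ HM]] <-] Vs].
have [tau [t01 Ht]] : exists tau : R, 0 <= tau < 2 /\
    forall r, V r -> ln (ln (max_modulus f r)) / ln r <= tau.
  move: Vs; set v := ereal_sup _ => Vs.
  have ub r : V r -> ((ln (ln (max_modulus f r)) / ln r)%:E <= v)%E.
    by move=> Vr; apply: ereal_sup_ubound; exists r.
  case: v Vs ub => [u Vs ub||_ ub] //.
  (* Truncation at 0 keeps [tau] nonnegative, so that multiplication by it is monotone later on. *)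
  -  exists (Num.max 0 u); split.
      by rewrite le_max lexx gt_max ltr0n /= -lte_fin.
    by move=> r /ub; rewrite lee_fin le_max => ->; rewrite orbT.
  - by exists 0; split => [|r /ub]; rewrite ?lexx ?ltr0n.
exists tau => //; exists (Num.max 2 (M + 1)) => z; rewrite ge_max => /andP[z2 zM].
(* Values of modulus at most 1 are treated apart: otherwise the maximum modulus exceeds 1, and both
   logarithms are genuine ones. *)
have [f1|f1] := leP (nrm (f z)) 1.
  by rewrite (le_trans f1) // -expR0 ler_expR expR_ge0.
have fM := max_modulus_ge z fe.
have l0 : 0 < ln (max_modulus f (nrm z)) by rewrite ln_gt0 // (lt_le_trans f1).
have lz : 0 < ln (nrm z) by rewrite ln_gt0 //; lra.
have := Ht (nrm z) (HM _ _); rewrite ler_pdivrMr // => h.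
apply: (le_trans fM).
have M0 : 0 < max_modulus f (nrm z) by apply: lt_le_trans fM; apply: lt_trans f1.
rewrite -[X in X <= _]lnK ?posrE // ler_expR -[X in X <= _]lnK ?posrE // ler_expR.
by apply: h; lra.
Qed.

Lemma growth_order_subquadratic f : centire f -> (growth_order f < 2%:E)%E ->
  subquadratic f.
Proof.
move=> fe /(growth_order_bound fe)[tau /andP[t0 t2] [r1 H]] eta r0 eta0.
have d0 : 0 < 2 - tau by rewrite subr_gt0.
(* With r = exp T and |z| <= 4r, the goal becomes tau (ln 4 + T) <= ln eta + 2T; solving for [T]
   gives the last entry. *)
pose T := Num.max (Num.max r0 r1) (Num.max 0 ((tau * ln 4 - ln eta) / (2 - tau))).
have T0 : r0 <= T by rewrite /T !le_max lexx.
have T1 : r1 <= T by rewrite /T !le_max lexx orbT.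
have T2 : 0 <= T by rewrite /T !le_max lexx !orbT.
have T3 : (tau * ln 4 - ln eta) / (2 - tau) <= T by rewrite /T !le_max lexx !orbT.
have eT := expR_ge1Dx T.
exists (expR T) => [|z /andP[z1 z2]]; first by lra.
have zr1 : r1 <= nrm z by lra.
have z0 : 0 < nrm z by lra.
apply: (le_trans (H z zr1)); rewrite ler_expR.
have -> : eta * expR T ^+ 2 = expR (ln eta + 2 * T).
  by rewrite expRD lnK ?posrE // expRM_natl.
rewrite ler_expR.
have e4 : 0 < 4 * expR T by rewrite mulr_gt0 ?expR_gt0.
have : ln (nrm z) <= ln 4 + T.
  by rewrite -[X in _ + X]expRK -lnM ?posrE ?expR_gt0 // ler_ln ?posrE.
move=> /(ler_wpM2l t0) h; apply: (le_trans h).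
by move: T3; rewrite ler_pdivrMr //; lra.
Qed.

End Growth.

(** * Pseudo cross-variograms and covariances *)

(** Scalar kernels on a finite type: pairs of a point index and a component index turn the
    matrix-valued quadratic form into a scalar one. *)
Definition psd (R : realType) (I : finType) (K : I -> I -> R) :=
  (forall p q, K p q = K q p) /\
  forall a : I -> R, 0 <= \sum_p \sum_q a p * K p q * a q.

Section Covariance.
Context d (T : measurableType d) (R : realType) (P : probability T R).
Implicit Types X Y : T -> R.
Local Notation L2 := (Lfun P 2%:E).

Definition rcov X Y : R := fine (covariance P X Y).

Lemma Lfun2_1 X : X \in L2 -> X \in Lfun P 1%E.
Proof. by move=> X2; rewrite Lfun_subset12 ?fin_num_measure. Qed.

Lemma rcov_fin X Y : X \in L2 -> Y \in L2 -> covariance P X Y \is a fin_num.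
Proof.
move=> X2 Y2; by apply: covariance_fin_num; [exact: Lfun2_1|exact: Lfun2_1|exact: (Lfun2_mul_Lfun1 X2 Y2)].
Qed.

Lemma rcovC X Y : rcov X Y = rcov Y X.
Proof. by rewrite /rcov covarianceC. Qed.

Lemma rcovDl X Y Z : X \in L2 -> Y \in L2 -> Z \in L2 ->
  rcov (X + Y) Z = rcov X Z + rcov Y Z.
Proof.
move=> X2 Y2 Z2; rewrite /rcov covarianceDl // fineD ?rcov_fin //.
Qed.

Lemma rcovZl a X Y : X \in L2 -> Y \in L2 -> rcov (a \*: X) Y = a * rcov X Y.
Proof.
move=> X2 Y2; rewrite /rcov (_ : a \*: X = a \o* X); last first.
  by apply: funext => x /=; rewrite mulrC.
rewrite covarianceZl; [|exact: Lfun2_1|exact: Lfun2_1|exact: (Lfun2_mul_Lfun1 X2 Y2)].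
by rewrite fineM ?rcov_fin.
Qed.

Lemma L2Z a X : X \in L2 -> a \*: X \in L2.
Proof.
move=> X2; rewrite (_ : a \*: X = a \o* X); first by apply: Lfun_scale => //; rewrite ler1n.
by apply: funext => x /=; rewrite mulrC.
Qed.

Lemma L2D X Y : X \in L2 -> Y \in L2 -> X + Y \in L2.
Proof. by move=> X2 Y2; rewrite rpredD ?lee1n. Qed.

Lemma L2_0 : (0 : T -> R) \in L2.
Proof. exact: (Lfun_cst P 0 2). Qed.

Lemma rcov_suml (I : Type) (r : seq I) (F : I -> T -> R) Y :
  (forall i, F i \in L2) -> Y \in L2 ->
  (\sum_(i <- r) F i \in L2) /\
  rcov (\sum_(i <- r) F i) Y = \sum_(i <- r) rcov (F i) Y.
Proof.
move=> F2 Y2; elim: r => [|i r [s2 E]].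
  rewrite !big_nil; split; first exact: L2_0.
  by rewrite /rcov (covariance_cst_l P 0 Y).
by rewrite !big_cons; split; [exact: L2D|rewrite rcovDl // E].
Qed.

Lemma rcov_sub X Y : X \in L2 -> Y \in L2 ->
  rcov (X + -1 \*: Y) (X + -1 \*: Y) = rcov X X + rcov Y Y - 2 * rcov X Y.
Proof.
move=> X2 Y2; have NY2 := L2Z (-1) Y2; have D2 := L2D X2 NY2.
rewrite (rcovDl X2 NY2 D2) (rcovZl _ Y2 D2) (rcovC X (X + _)) (rcovC Y (X + _)).
rewrite (rcovDl X2 NY2 X2) (rcovDl X2 NY2 Y2) (rcovZl _ Y2 X2) (rcovZl _ Y2 Y2).
by rewrite (rcovC Y X); ring.
Qed.

(** Only differences of the field are square integrable, so everything is centred at a reference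
    index: with V p = W p - W p0 and K the covariance of V, half the variance of V p - V q is K p p
    / 2 + K q q / 2 - K p q. *)
Lemma variogram_decomp (I : finType) (W : I -> T -> R) (G : I -> I -> R) :
  (forall p q, W p \- W q \in L2) ->
  (forall p q, (G p q)%:E = ((2^-1)%:E * 'V_P[(W p \- W q)%R])%E) ->
  exists (u : I -> R) (K : I -> I -> R), psd K /\ forall p q, G p q = u p + u q - K p q.
Proof.
move=> W2 GE; case: (pickP (mem I)) => [p0 _|I0]; last first.
  exists (fun=> 0), (fun=> fun=> 0); split; last by move=> p; have := I0 p.
  by split=> // a; rewrite big1 // => p; have := I0 p.
pose V p := W p \- W p0.
have V2 p : V p \in L2 by exact: W2.
pose K p q := rcov (V p) (V q).
exists (fun p => K p p / 2), K; split; last first.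
  move=> p q; have -> : G p q = fine (G p q)%:E by [].
  have E : W p \- W q = V p + (-1) \*: V q.
    apply: funext => x.
    by change (W p x - W q x = (W p x - W p0 x) + (-1) * (W q x - W p0 x)); ring.
  have Vq : (-1) \*: V q \in L2 by exact: L2Z.
  have Vpq : V p + (-1) \*: V q \in L2 by exact: L2D.
  rewrite GE fineM ?variance_fin_num // /variance E.
  have -> : fine (covariance P (V p + -1 \*: V q) (V p + -1 \*: V q)) =
      rcov (V p + -1 \*: V q) (V p + -1 \*: V q) by [].
  by rewrite rcov_sub //= /K; field.
split=> [p q|a]; first by rewrite /K rcovC.
pose S := \sum_(p : I) (a p \*: V p).
have aV p : a p \*: V p \in L2 by exact: L2Z.
have S2 : S \in L2 := (rcov_suml (index_enum I) aV L2_0).1.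
have : 0 <= rcov S S by rewrite fine_ge0 //; exact: variance_ge0.
rewrite (rcov_suml _ aV S2).2 => /le_trans; apply; rewrite le_eqVlt; apply/orP; left.
apply/eqP; apply: eq_bigr => p _; rewrite rcovC (rcov_suml _ aV (aV p)).2.
apply: eq_bigr => q _; rewrite rcovZl // rcovC rcovZl // /K; ring.
Qed.

End Covariance.

(** * Positive semidefinite kernels *)

Section Kernels.
Variables (R : realType) (I : finType).
Implicit Types (K L : I -> I -> R) (a b : I -> R).

Definition kform K a b := \sum_p \sum_q a p * K p q * b q.
Definition delta (p0 : I) (p : I) : R := (p == p0)%:R.

Lemma sum_delta (F : I -> R) p0 : \sum_p F p * delta p0 p = F p0.
Proof.
rewrite (bigD1 p0) //= /delta eqxx mulr1 big1 ?addr0 // => p /negbTE ->.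
by rewrite mulr0.
Qed.

Lemma kform_deltar K a p0 : kform K a (delta p0) = \sum_p a p * K p p0.
Proof. by apply: eq_bigr => p _; rewrite sum_delta. Qed.

Lemma kform_sub K a t p0 : (forall p q, K p q = K q p) ->
  kform K (fun p => a p - t * delta p0 p) (fun p => a p - t * delta p0 p) =
  kform K a a - 2 * t * (\sum_p a p * K p p0) + t ^+ 2 * K p0 p0.
Proof.
move=> Ks.
have E : forall p q, (a p - t * delta p0 p) * K p q * (a q - t * delta p0 q) =
   a p * K p q * a q + (- t * (a p * K p q) * delta p0 q +
   (- t * (K p q * a q) * delta p0 p + t ^+ 2 * (K p q * delta p0 q) * delta p0 p)).
  by move=> p q; ring.
rewrite /kform (eq_bigr (fun p => \sum_q a p * K p q * a q + (\sum_q - t * (a p * K p q) * delta p0 q +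
   (\sum_q - t * (K p q * a q) + \sum_q t ^+ 2 * (K p q * delta p0 q)) * delta p0 p))); last first.
  move=> p _; rewrite (eq_bigr _ (fun q _ => E p q)) !big_split /= -!mulr_suml.
  by congr (_ + (_ + _)); rewrite mulrDl.
rewrite !big_split /= sum_delta -!mulr_sumr sum_delta.
have -> : \sum_p \sum_q - t * (a p * K p q) * delta p0 q = - t * \sum_p a p * K p p0.
  by rewrite mulr_sumr; apply: eq_bigr => p _; rewrite sum_delta.
have -> : \sum_i K p0 i * a i = \sum_p a p * K p p0.
  by apply: eq_bigr => p _; rewrite mulrC Ks.
ring.
Qed.

Lemma psd_diag K p : psd K -> 0 <= K p p.
Proof.
move=> [Ks /(_ (delta p))]; suff -> : \sum_p0 \sum_q delta p p0 * K p0 q * delta p q = K p p by [].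
rewrite -/(kform K (delta p) (delta p)) kform_deltar.
by rewrite (eq_bigr (fun p0 => K p0 p * delta p p0)) ?sum_delta // => q _; rewrite mulrC.
Qed.

(** One Cholesky step: the form of the Schur complement at [a] is the form of [K] at [a] shifted
    along [p0] so as to complete the square. *)
Lemma psd_deflate K p0 : psd K -> 0 < K p0 p0 ->
  psd (fun p q => K p q - K p p0 / K p0 p0 * K q p0).
Proof.
move=> [Ks Kp] k0; split=> [p q|a]; first by rewrite Ks; ring.
set S := \sum_p a p * K p p0.
have := Kp (fun p => a p - S / K p0 p0 * delta p0 p).
rewrite -/(kform _ _ _) kform_sub // -/S.
have -> : kform K a a - 2 * (S / K p0 p0) * S + (S / K p0 p0) ^+ 2 * K p0 p0 =
  kform K a a - S * S / K p0 p0 by field; rewrite gt_eqF.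
have -> // : \sum_p \sum_q a p * (K p q - K p p0 / K p0 p0 * K q p0) * a q =
  kform K a a - S * S / K p0 p0.
rewrite {1}/S !mulr_suml -sumrB; apply: eq_bigr => p _.
rewrite -mulrA {1}/S mulr_suml mulr_sumr -sumrB; apply: eq_bigr => q _.
by rewrite mulrBr mulrBl; congr (_ - _); ring.
Qed.

(** Without its square term, the form along a line in direction [p] is affine in the parameter, and
    nonnegative only if its slope vanishes. *)
Lemma psd_diag0 K p q : psd K -> K p p = 0 -> K p q = 0.
Proof.
move=> Kpsd Kpp; have [Ks Kp] := Kpsd.
pose S t := kform K (fun r => delta q r - t * delta p r) (fun r => delta q r - t * delta p r).
have HS t : 0 <= K q q - 2 * t * K q p.
  have : 0 <= S t by exact: Kp.
  rewrite /S kform_sub // Kpp mulr0 addr0 kform_deltar.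
  have -> : forall r, \sum_p0 delta q p0 * K p0 r = K q r.
    by move=> r; rewrite (eq_bigr (fun p0 => K p0 r * delta q p0)) ?sum_delta // => ? _; rewrite mulrC.
  have -> // : \sum_p0 delta q p0 * K p0 p = K q p.
  by rewrite (eq_bigr (fun p0 => K p0 p * delta q p0)) ?sum_delta // => ? _; rewrite mulrC.
apply/eqP; rewrite Ks; apply: contraT => k0.
(* The parameter at which the affine expression would equal -1. *)
have := HS ((K q q + 1) / (2 * K q p)).
have -> : 2 * ((K q q + 1) / (2 * K q p)) * K q p = K q q + 1 by field.
lra.
Qed.

(** Cholesky by induction on the number of nonzero diagonal entries: a deflation kills the one at
    [p0] and preserves null ones. *)
Lemma psd_gram K : psd K -> exists vs : seq (I -> R),
  forall p q, K p q = \sum_(v <- vs) v p * v q.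
Proof.
have [n] := ubnP #|[pred p | K p p != 0]|; elim: n K => // n IH K Kn Kpsd.
have [[p0 k0]|Hno] := pselect (exists p0, K p0 p0 != 0); last first.
  exists [::] => p q; rewrite big_nil; apply: psd_diag0 => //.
  by apply/eqP; apply: contraT => kp; exfalso; apply: Hno; exists p.
have kp0 : 0 < K p0 p0 by rewrite lt_def k0 psd_diag.
have Lpsd := psd_deflate Kpsd kp0.
have [|vs Hvs] := IH _ _ Lpsd.
  rewrite -ltnS; apply: leq_trans Kn; rewrite ltnS; apply: proper_card.
  apply/properP; split; last first.
    by exists p0; rewrite !inE // divff // mul1r subrr eqxx.
  apply/fintype.subsetP => p; rewrite !inE; apply: contraNneq => kp.
  by rewrite kp (psd_diag0 p0 Kpsd kp) mul0r mul0r subrr.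
exists ((fun p => K p p0 / Num.sqrt (K p0 p0)) :: vs) => p q.
rewrite big_cons -Hvs.
have s0 : Num.sqrt (K p0 p0) != 0 by rewrite gt_eqF // sqrtr_gt0.
have -> : K p p0 / Num.sqrt (K p0 p0) * (K q p0 / Num.sqrt (K p0 p0)) =
  K p p0 * K q p0 / Num.sqrt (K p0 p0) ^+ 2 by field.
by rewrite sqr_sqrtr ?ltW //; ring.
Qed.

Lemma psd_eq K L : (forall p q, K p q = L p q) -> psd K -> psd L.
Proof.
move=> KL [Ks Kp]; split=> [p q|a]; first by rewrite -!KL.
have := Kp a; rewrite (eq_bigr (fun p => \sum_q a p * L p q * a q)) // => p _.
by apply: eq_bigr => q _; rewrite KL.
Qed.

Lemma psd0 : psd (fun _ _ : I => 0 : R).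
Proof.
by split=> // a; rewrite big1 // => p _; rewrite big1 // => q _; rewrite mulr0 mul0r.
Qed.

Lemma psdD K L : psd K -> psd L -> psd (fun p q => K p q + L p q).
Proof.
move=> [Ks Kp] [Ls Lp]; split=> [p q|a]; first by rewrite Ks Ls.
rewrite (eq_bigr (fun p => \sum_q a p * K p q * a q + \sum_q a p * L p q * a q)).
  by rewrite big_split addr_ge0.
by move=> p _; rewrite -big_split; apply: eq_bigr => q _; rewrite mulrDr mulrDl.
Qed.

Lemma psdZ c K : 0 <= c -> psd K -> psd (fun p q => c * K p q).
Proof.
move=> c0 [Ks Kp]; split=> [p q|a]; first by rewrite Ks.
rewrite (eq_bigr (fun p => c * \sum_q a p * K p q * a q)).
  by rewrite -mulr_sumr mulr_ge0.
by move=> p _; rewrite mulr_sumr; apply: eq_bigr => q _; ring.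
Qed.

Lemma psd_rank1 (u : I -> R) : psd (fun p q => u p * u q).
Proof.
split=> [p q|a]; first by rewrite mulrC.
rewrite (eq_bigr (fun p => (a p * u p) * \sum_q a q * u q)).
  by rewrite -mulr_suml -expr2 sqr_ge0.
by move=> p _; rewrite mulr_sumr; apply: eq_bigr => q _; ring.
Qed.

Lemma psd_scale (u : I -> R) K : psd K -> psd (fun p q => u p * K p q * u q).
Proof.
move=> [Ks Kp]; split=> [p q|a]; first by rewrite Ks; ring.
have := Kp (fun p => a p * u p).
rewrite (eq_bigr (fun p => \sum_q a p * (u p * K p q * u q) * a q)) // => p _.
by apply: eq_bigr => q _; ring.
Qed.

Lemma psd_sum (J : eqType) (r : seq J) (F : J -> I -> I -> R) :
  (forall j, j \in r -> psd (F j)) -> psd (fun p q => \sum_(j <- r) F j p q).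
Proof.
elim: r => [|j r IH] H.
  by apply: psd_eq psd0 => p q; rewrite big_nil.
apply: psd_eq (psdD (H j (mem_head _ _)) (IH _)) => [p q|k kr]; first by rewrite big_cons.
by apply: H; rewrite inE kr orbT.
Qed.

(** Schur's product theorem: a Gram decomposition of [K] writes the entrywise product as a sum of
    diagonal rescalings of [L]. *)
Lemma psd_schur K L : psd K -> psd L -> psd (fun p q => K p q * L p q).
Proof.
move=> /psd_gram[vs Hv] Lp.
apply: (psd_eq (K := fun p q => \sum_(j <- iota 0 (size vs))
    (nth (fun=> 0) vs j p * L p q * nth (fun=> 0) vs j q))).
  move=> p q; rewrite Hv mulr_suml (big_nth (fun=> 0)) /index_iota subn0.
  by apply: eq_bigr => j _; ring.
by apply: psd_sum => j _; exact: psd_scale.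
Qed.

Lemma psd1 : psd (fun _ _ : I => 1 : R).
Proof. by apply: psd_eq (psd_rank1 (fun=> 1)) => p q; rewrite mulr1. Qed.

Lemma psdX K n : psd K -> psd (fun p q => K p q ^+ n).
Proof.
move=> Kp; elim: n => [|n IH]; first by apply: psd_eq psd1 => p q; rewrite expr0.
by apply: psd_eq (psd_schur Kp IH) => p q; rewrite exprS.
Qed.

Lemma psd_cvg (Kn : nat -> I -> I -> R) K : (forall n, psd (Kn n)) ->
  (forall p q, (fun n => Kn n p q) @ \oo --> K p q) -> psd K.
Proof.
move=> Kp Kc; split=> [p q|a].
  have h := Kc p q; rewrite (_ : (fun n => Kn n p q) = (fun n => Kn n q p)) in h.
    exact: etrans (esym (cvg_lim (@Rhausdorff R) h)) (cvg_lim (@Rhausdorff R) (Kc q p)).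
  by apply: funext => n; rewrite (Kp n).1.
have C : (fun n => \sum_p \sum_q a p * Kn n p q * a q) @ \oo -->
    \sum_p \sum_q a p * K p q * a q.
  apply: cvg_big => [|p _]; first exact: add_continuous.
  apply: cvg_big => [|q _]; first exact: add_continuous.
  by apply: cvgMl; apply: cvgMr; exact: Kc.
rewrite -(cvg_lim _ C) //.
apply: limr_ge; first by apply/cvg_ex; eexists; exact: C.
by near=> n; exact: (Kp n).2.
Unshelve. all: by end_near. Qed.

Lemma psd_exp K : psd K -> psd (fun p q => expR (K p q)).
Proof.
move=> Kp; apply: (@psd_cvg (fun n p q => series (exp_coeff (K p q)) n)).
  move=> n; apply: (psd_eq (K := fun p q => \sum_(k <- iota 0 n) (k`!%:R^-1 * K p q ^+ k))).
    by move=> p q; rewrite /series /= /index_iota subn0; apply: eq_bigr => k _; rewrite mulrC.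
  by apply: psd_sum => k _; apply: psdZ; [rewrite invr_ge0|exact: psdX].
by move=> p q; exact: is_cvg_series_exp_coeff.
Qed.

Lemma psd_exp_variogram (G : I -> I -> R) u K t : psd K ->
  (forall p q, G p q = u p + u q - K p q) -> 0 <= t ->
  psd (fun p q => expR (- t * G p q)).
Proof.
move=> Kp GE t0.
apply: psd_eq (psd_scale (fun p => expR (- t * u p)) (psd_exp (psdZ t0 Kp))) => p q.
by rewrite -!expRD GE; congr expR; ring.
Qed.

(* Exponentials of such kernels are infinitely divisible. *)
Definition cpd K := forall r, 0 <= r -> psd (fun p q => expR (r * K p q)).

Lemma cpd_psd K : psd K -> cpd K.
Proof. by move=> Kp r r0; apply: psd_exp; exact: psdZ. Qed.

Lemma cpdD K L : cpd K -> cpd L -> cpd (fun p q => K p q + L p q).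
Proof.
move=> Kc Lc r r0; apply: psd_eq (psd_schur (Kc r r0) (Lc r r0)) => p q.
by rewrite -expRD mulrDr.
Qed.

Lemma cpdZ c K : 0 <= c -> cpd K -> cpd (fun p q => c * K p q).
Proof.
move=> c0 Kc r r0; apply: psd_eq (Kc (r * c) (mulr_ge0 r0 c0)) => p q.
by rewrite mulrA.
Qed.

(** The sign of [c] is free, since only exp (r c) >= 0 matters; a negative constant such as ln c
    with c < 1 may thus be added. *)
Lemma cpd_cst c : cpd (fun _ _ => c).
Proof.
move=> r r0; apply: psd_eq (psdZ (expR_ge0 (r * c)) psd1) => p q.
by rewrite mulr1.
Qed.

Lemma cpd_cvg (Kn : nat -> I -> I -> R) K : (forall n, cpd (Kn n)) ->
  (forall p q, (fun n => Kn n p q) @ \oo --> K p q) -> cpd K.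
Proof.
move=> Kp Kc r r0; apply: (@psd_cvg (fun n p q => expR (r * Kn n p q))).
  by move=> n; exact: Kp.
move=> p q; apply: (@continuous_cvg nat R R \oo _ (fun n => r * Kn n p q) expR (r * K p q)).
  exact: continuous_expR.
by apply: cvgMr; exact: Kc.
Qed.

Lemma cpd_sum (J : eqType) (r : seq J) (F : J -> I -> I -> R) :
  (forall j, j \in r -> cpd (F j)) -> cpd (fun p q => \sum_(j <- r) F j p q).
Proof.
elim: r => [|j r IH] H c c0.
  by apply: psd_eq (cpd_cst 0 c0) => p q; rewrite big_nil.
have Hr : cpd (fun p q => \sum_(j <- r) F j p q).
  by apply: IH => k kr; apply: H; rewrite inE kr orbT.
by apply: psd_eq (cpdD (H j (mem_head _ _)) Hr c0) => p q; rewrite big_cons.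
Qed.

End Kernels.

(** * The power series of the logarithm and its behaviour near 1 *)

Section LogSeries.
Variable R : realType.

Lemma cvg_geometric_bound (u : R^nat) (l C q : R) : 0 <= q < 1 ->
  (forall n, `|u n - l| <= C * q ^+ n) -> u @ \oo --> l.
Proof.
move=> /andP[q0 q1] H; apply/cvgrPdist_le => e e0.
have C0 : (fun n => C * q ^+ n) @ \oo --> C * 0.
  by apply: cvgMr; apply: cvg_expr; rewrite ger0_norm.
move: C0; rewrite mulr0 => /cvgrPdist_le/(_ e e0); apply: filterS => n.
rewrite sub0r normrN distrC => h; apply: le_trans (H n) _.
exact: le_trans (ler_norm _) h.
Qed.

Lemma cvg_harmonic_bound (u : R^nat) (l C : R) :
  (forall n, `|u n - l| <= C * n.+1%:R^-1) -> u @ \oo --> l.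
Proof.
move=> H; apply/cvgrPdist_le => e e0.
have C0 : (fun n => C * harmonic n) @ \oo --> C * 0.
  by apply: cvgMr; exact: cvg_harmonic.
move: C0; rewrite mulr0 => /cvgrPdist_le/(_ e e0); apply: filterS => n.
rewrite sub0r normrN distrC => h; apply: le_trans (H n) _.
exact: le_trans (ler_norm _) h.
Qed.

(** By the geometric sum, ln (1 - x) plus the partial sum has derivative -x^n / (1 - x); on [0, w]
    the mean value inequality bounds it by a constant times w^n. *)
Lemma ln_series (w : R) : 0 <= w < 1 ->
  (fun n => \sum_(k < n) w ^+ k.+1 / k.+1%:R) @ \oo --> - ln (1 - w).
Proof.
move=> /andP[w0 w1].
apply: (@cvg_geometric_bound _ _ (w / (1 - w)) w) => [|n]; first by rewrite w0.
pose g (x : R) := ln (1 - x) + \sum_(k < n) x ^+ k.+1 / k.+1%:R.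
have dpow (x : R) (k : nat) : is_derive x 1 (fun y : R => y ^+ k.+1 / k.+1%:R) (x ^+ k).
  have := rdiff_Re (tdiffZ (k.+1%:R^-1)%:C%C (tdiffX k.+1 (rdiff_id x))).
  move=> h; have E (y : R) : complex.Re ((k.+1%:R^-1)%:C%C * y%:C%C ^+ k.+1) = y ^+ k.+1 / k.+1%:R.
    by rewrite -rmorphXn -rmorphM /= mulrC.
  rewrite (_ : (fun y => _) = (fun y : R => complex.Re ((k.+1%:R^-1)%:C%C * y%:C%C ^+ k.+1))).
    apply: is_derive_eq h _.
    rewrite /= mulr1 -(rmorph_nat (real_complex R)) -rmorphXn -!rmorphM /=.
    by rewrite mulKf // pnatr_eq0.
  by apply: funext => y; rewrite E.
have dsum (x : R) m : is_derive x 1 (fun y : R => \sum_(k < m) y ^+ k.+1 / k.+1%:R)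
    (\sum_(k < m) x ^+ k).
  elim: m => [|m IH].
    rewrite big_ord0 (_ : (fun y => _) = cst 0); first exact: is_derive_cst.
    by apply: funext => y; rewrite big_ord0.
  rewrite big_ord_recr /= (_ : (fun y => _) =
    (fun y : R => \sum_(k < m) y ^+ k.+1 / k.+1%:R) + (fun y : R => y ^+ m.+1 / m.+1%:R)).
    exact: is_deriveD.
  by apply: funext => y; rewrite big_ord_recr.
have dg x : 0 <= x <= w -> is_derive x 1 g (- (x ^+ n / (1 - x))).
  move=> /andP[x0 xw].
  have x1 : 0 < 1 - x by lra.
  have dl : is_derive x 1 (fun y : R => ln (1 - y)) ((1 - x)^-1 * -1).
    apply: (is_derive1_comp (f := @ln R) (g := fun y => 1 - y)); first exact: is_derive1_ln.
    apply/is_derive_epsP => e e0; exists 1 => // y _.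
    by rewrite (_ : _ - _ - _ = 0) ?normr0 ?mulr_ge0 ?(ltW e0) //; ring.
  apply: is_derive_eq (is_deriveD dl (dsum x n)) _.
  have := subrX1 x n => E.
  apply: (mulfI (lt0r_neq0 x1)).
  have -> : (1 - x) * ((1 - x)^-1 * -1 + \sum_(i < n) x ^+ i) = -1 - (x - 1) * \sum_(i < n) x ^+ i.
    by field; rewrite gt_eqF.
  by rewrite -E; field; rewrite gt_eqF.
have := @rdiff_bound R (fun x => (g x)%:C%C) (fun x => (- (x ^+ n / (1 - x)))%:C%C) 0 w
   (w ^+ n / (1 - w)) w0.
have -> : g 0 = 0.
  rewrite /g subr0 ln1 add0r big1 // => k _; by rewrite expr0n mul0r.
rewrite rmorph0 !subr0 nrm_real => H.
have -> : \sum_(k < n) w ^+ k.+1 / k.+1%:R - - ln (1 - w) = g w by rewrite /g; ring.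
apply: le_trans (H _ _) _; last by rewrite le_eqVlt; apply/orP; left; apply/eqP; ring.
- by move=> x xw; apply: rdiff_real; exact: dg.
- move=> x /andP[x0 xw]; rewrite nrm_real normrN ger0_norm; last first.
    by rewrite divr_ge0 ?exprn_ge0 //; lra.
  rewrite ler_pM ?exprn_ge0 ?invr_ge0 //; first by lra.
    by rewrite lerXn2r ?nnegrE.
  by rewrite lef_pV2 ?posrE; lra.
Qed.

(** From y / (1 + y) <= 1 - exp(-y) <= y with y = e x. In a difference of two such logarithms the
    divergent term ln e cancels. *)
Lemma ln_1Nexp (e x : R) : 0 < e -> 0 < x ->
  `|ln (1 - expR (- (e * x))) - ln e - ln x| <= e * x.
Proof.
move=> e0 x0; have y0 : 0 < e * x by rewrite mulr_gt0.
rewrite -addrA -opprD -lnM ?posrE //.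
move: (e * x) y0 => y y0.
have h1 : 1 - expR (- y) <= y by have := expR_ge1Dx (- y); lra.
have h2 : y / (1 + y) <= 1 - expR (- y).
  have y1 : 0 < 1 + y by lra.
  have : expR (- y) <= (1 + y)^-1.
    by rewrite expRN lef_pV2 ?posrE ?expR_gt0 // expR_ge1Dx.
  have -> : y / (1 + y) = 1 - (1 + y)^-1 by field; rewrite gt_eqF.
  lra.
have h3 : 0 < y / (1 + y) by rewrite divr_gt0 //; lra.
have h4 : 0 < 1 - expR (- y) by apply: lt_le_trans h2.
have : ln (1 - expR (- y)) <= ln y by rewrite ler_ln.
have : ln (y / (1 + y)) <= ln (1 - expR (- y)) by rewrite ler_ln.
rewrite ln_div ?posrE //; last by lra.
have : ln (1 + y) <= y by apply: le_ln1Dx; lra.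
by rewrite ler_norml => ? ? ?; apply/andP; split; lra.
Qed.

End LogSeries.

(** * Logarithms of ratios of affine functions of a kernel *)

Section BernsteinKernel.
Variables (R : realType) (I : finType) (H : I -> I -> R).
Hypothesis H_ge0 : forall p q, 0 <= H p q.
Hypothesis expH_psd : forall t, 0 <= t -> psd (fun p q => expR (- t * H p q)).

(** Expanding both logarithms gives powers of exp (-e H) with coefficients (exp(-e)^k - exp(-e b)^k)
    / k, nonnegative exactly because [b >= 1]. *)
Lemma cpd_ln_1Nexp (e b : R) : 0 < e -> 1 <= b ->
  cpd (fun p q => ln (1 - expR (- (e * (b + H p q)))) - ln (1 - expR (- (e * (1 + H p q))))).
Proof.
move=> e0 b1.
apply: (@cpd_cvg _ _ (fun n p q => \sum_(k < n)
   (expR (- (e * (1 + H p q))) ^+ k.+1 / k.+1%:R) -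
   \sum_(k < n) (expR (- (e * (b + H p q))) ^+ k.+1 / k.+1%:R))).
  move=> n; apply: cpd_psd.
  apply: (psd_eq (K := fun p q => \sum_(k <- enum 'I_n)
    (((expR (- e) ^+ k.+1 - expR (- (e * b)) ^+ k.+1) / k.+1%:R) * expR (- e * H p q) ^+ k.+1))).
    move=> p q; rewrite -sumrB big_enum /=; apply: eq_bigr => k _.
    have -> : - (e * (1 + H p q)) = - e + - e * H p q by ring.
    have -> : - (e * (b + H p q)) = - (e * b) + - e * H p q by ring.
    by rewrite !expRD !exprMn; ring.
  apply: psd_sum => k _; apply: psdZ; last by apply: psdX; apply: expH_psd; rewrite ltW.
  rewrite divr_ge0 // subr_ge0 lerXn2r ?nnegrE ?expR_ge0 // ler_expR lerN2.
  by rewrite ler_peMr // ltW.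
move=> p q.
have w01 (c : R) : 1 <= c -> 0 <= expR (- (e * (c + H p q))) < 1.
  move=> c1; rewrite expR_ge0 /= expR_lt1 oppr_lt0 mulr_gt0 //.
  by rewrite ltr_pwDl // (lt_le_trans ltr01 c1).
have -> : ln (1 - expR (- (e * (b + H p q)))) - ln (1 - expR (- (e * (1 + H p q)))) =
   - ln (1 - expR (- (e * (1 + H p q)))) - - ln (1 - expR (- (e * (b + H p q)))) by ring.
by apply: cvgB; apply: ln_series; apply: w01.
Qed.

Lemma cpd_ln_shift (b : R) : 1 <= b -> cpd (fun p q => ln (b + H p q) - ln (1 + H p q)).
Proof.
move=> b1.
apply: (@cpd_cvg _ _ (fun n p q => ln (1 - expR (- (n.+1%:R^-1 * (b + H p q)))) -
   ln (1 - expR (- (n.+1%:R^-1 * (1 + H p q)))))).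
  by move=> n; apply: cpd_ln_1Nexp => //; rewrite invr_gt0.
move=> p q; have h := H_ge0 p q.
apply: (@cvg_harmonic_bound _ _ _ (b + H p q + (1 + H p q))) => n.
have e0 : 0 < n.+1%:R^-1 :> R by rewrite invr_gt0.
have := ln_1Nexp e0 (ltr_wpDr h (lt_le_trans ltr01 b1)).
have := ln_1Nexp e0 (ltr_wpDr h (@ltr01 R)).
move: (n.+1%:R^-1) e0 => e e0.
rewrite !ler_norml => /andP[? ?] /andP[? ?]; apply/andP; split; lra.
Qed.

(** For [b > 0], 1 + b s = b (1/b + s) reduces to a shift by 1/b >= 1 plus the constant ln b. The
    value [b = 0], reached when nu = 0, is a limit. *)
Lemma cpd_ln_ratio (b : R) : 0 <= b <= 1 ->
  cpd (fun p q => ln (1 + b * H p q) - ln (1 + H p q)).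
Proof.
have pos c : 0 < c <= 1 -> cpd (fun p q => ln (1 + c * H p q) - ln (1 + H p q)).
  move=> /andP[c0 c1] r r0.
  have ci : 1 <= c^-1 by rewrite invr_ge1 ?unitfE ?gt_eqF.
  apply: psd_eq (cpdD (cpd_cst I (ln c)) (cpd_ln_shift ci) r0) => p q.
  congr (expR (r * _)); rewrite addrA; congr (_ - _).
  have h : 0 < c^-1 + H p q by rewrite ltr_wpDr // invr_gt0.
  by rewrite -lnM ?posrE // mulrDr divff ?gt_eqF.
move=> /andP[b0 b1]; have [b0'|b0'] := ltP 0 b; first by apply: pos; rewrite b0'.
have -> : b = 0 by apply/eqP; rewrite eq_le b0 b0'.
apply: (@cpd_cvg _ _ (fun n p q => ln (1 + n.+1%:R^-1 * H p q) - ln (1 + H p q))).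
  by move=> n; apply: pos; rewrite invr_gt0 ltr0n /= invf_le1 ?ler1n.
move=> p q; have h := H_ge0 p q.
apply: (@cvg_harmonic_bound _ _ _ (H p q)) => n.
have e0 : 0 <= n.+1%:R^-1 * H p q by rewrite mulr_ge0.
rewrite mul0r addr0 ln1.
have -> : ln (1 + n.+1%:R^-1 * H p q) - ln (1 + H p q) - (0 - ln (1 + H p q)) =
  ln (1 + n.+1%:R^-1 * H p q) by ring.
rewrite ger0_norm ?ln_ge0 ?lerDl // [X in _ <= X]mulrC.
by apply: le_ln1Dx; rewrite (lt_le_trans _ e0) // ltrN10.
Qed.

End BernsteinKernel.

(** * Infinite divisibility *)

Section RealRatio.
Variables (R : realType) (f : R[i] -> R[i]).
Hypothesis fe : centire f.
Hypothesis f_real : forall x : R, complex.Im (f x%:C) = 0.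
Hypothesis f0_gt0 : 0 < f 0.
Hypothesis df0 : cdiff f 0 0.
Hypothesis f_zeros : forall z : R[i], f z = 0 -> complex.Re z = 0.
Hypothesis f_sub : subquadratic f.

Let ff (x : R) := complex.Re (f x%:C).

Lemma restrictE x : f x%:C = (ff x)%:C.
Proof. by apply: c_eq => //=; exact: f_real. Qed.

Lemma restrict_neq0 x : ff x != 0.
Proof.
apply/negP => /eqP fx0; have fx : f x%:C = 0 by rewrite restrictE fx0.
have /= x0 := f_zeros fx.
by move: f0_gt0; rewrite -[X in f X]/(0%:C) -x0 fx ltxx.
Qed.

(** A real zero would be purely imaginary, hence 0, where [f] is positive; the intermediate value
    theorem then fixes the sign. *)
Lemma restrict_gt0 x : 0 <= x -> 0 < ff x.
Proof.
move=> x0; rewrite lt_def restrict_neq0 /= leNgt; apply/negP => fx.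
have ff0 : 0 < ff 0 by move: f0_gt0; rewrite -[X in f X]/(0%:C) restrictE ltcR.
have cont : {within `[0, x], continuous ff}.
  apply: derivable_within_continuous => y _; have [l fl] := fe y%:C.
  by have [] := rdiff_Re (tdiff_comp fl (rdiff_id y)).
have [|c _ /eqP] := IVT x0 cont (v := 0).
  by rewrite ge_min le_max (ltW fx) (ltW ff0) !orbT.
by rewrite (negbTE (restrict_neq0 c)).
Qed.

Lemma nrm_restrict x : 0 <= x -> nrm (f x%:C) = ff x.
Proof. by move=> x0; rewrite restrictE nrm_real gtr0_norm // restrict_gt0. Qed.

Lemma cpd_ln_restrict (I : finType) (G : I -> I -> R) (nu : R) : 0 <= nu <= 1 ->
  (forall p q, 0 <= G p q) ->
  (forall t, 0 <= t -> psd (fun p q => expR (- t * G p q))) ->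
  cpd (fun p q => ln (ff (nu * Num.sqrt (G p q))) - ln (ff (Num.sqrt (G p q)))).
Proof.
move=> /andP[nu0 nu1] G0 Gpsd.
(* A common upper bound for the finitely many arguments; it also covers their multiples by [nu], as
   [nu <= 1]. *)
pose X := \sum_p \sum_q Num.sqrt (G p q).
have GX p q : Num.sqrt (G p q) <= X.
  rewrite /X (bigD1 p) //= (bigD1 q) //= -addrA lerDl addr_ge0 // sumr_ge0 // => r _.
  by rewrite sumr_ge0.
have f00 : f 0 != 0 by rewrite gt_eqF.
have /choice[ts Hts] : forall n : nat, exists ts : seq R, (forall t, t \in ts -> 0 <= t) /\
  forall x, 0 <= x <= X -> `|ln (nrm (f x%:C)) - ln (nrm (f 0)) -
    2^-1 * \sum_(t <- ts) ln (1 + t * x ^+ 2)| <= n.+1%:R^-1.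
  move=> n; have n0 : 0 < n.+1%:R^-1 :> R by rewrite invr_gt0.
  by have [ts H1 H2] := hadamard fe f00 df0 f_zeros f_sub X n0; exists ts.
apply: (@cpd_cvg _ _ (fun n p q => 2^-1 *
   \sum_(t <- ts n) (ln (1 + nu ^+ 2 * (t * G p q)) - ln (1 + t * G p q)))).
  move=> n; apply: cpdZ; first by rewrite invr_ge0.
  apply: cpd_sum => t /(Hts n).1 t0.
  apply: (cpd_ln_ratio (H := fun p q => t * G p q)).
  - by move=> p q; exact: mulr_ge0.
  - move=> u u0; apply: psd_eq (Gpsd (u * t) (mulr_ge0 u0 t0)) => p q.
    by congr expR; ring.
  - by rewrite exprn_ge0 // expr_le1.
(* One approximation error for each of the two logarithms; ln f(0) cancels because both use the same
   list [ts n]. *)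
move=> p q; apply: (@cvg_harmonic_bound _ _ _ 2) => n.
have s0 : 0 <= Num.sqrt (G p q) by [].
have s1 : 0 <= nu * Num.sqrt (G p q) by rewrite mulr_ge0.
have s2 : nu * Num.sqrt (G p q) <= X by rewrite (le_trans _ (GX p q)) // ler_piMl.
have := (Hts n).2 (Num.sqrt (G p q)); rewrite s0 GX => /(_ isT).
have := (Hts n).2 (nu * Num.sqrt (G p q)); rewrite s1 s2 => /(_ isT).
rewrite !nrm_restrict // exprMn sqr_sqrtr //.
have E1 : \sum_(t <- ts n) ln (1 + t * (nu ^+ 2 * G p q)) =
          \sum_(t <- ts n) ln (1 + nu ^+ 2 * (t * G p q)).
  by apply: eq_bigr => t _; congr (ln (1 + _)); ring.
rewrite E1 sumrB.
set A := \sum_(t <- ts n) _; set B := \sum_(t <- ts n) _; set L := ln (nrm (f 0)).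
move: (ln (ff _)) (ln (ff _)) n.+1%:R^-1 => a b e.
rewrite !ler_norml => /andP[? ?] /andP[? ?]; apply/andP; split; lra.
Qed.

End RealRatio.

Section PseudoCrossVariogram.
Variables (R : realType) (d m n : nat) (gamma : 'rV[R]_d -> 'M[R]_m).
Hypothesis hgamma : pseudo_cross_variogram gamma.
Variable x : 'I_n -> 'rV[R]_d.

Definition variogram_kernel (p q : 'I_n * 'I_m) : R := gamma (x p.1 - x q.1) p.2 q.2.
Local Notation G := variogram_kernel.

Lemma variogram_kernelP : (forall p q, 0 <= G p q) /\
  exists (u : 'I_n * 'I_m -> R) (K : 'I_n * 'I_m -> 'I_n * 'I_m -> R),
    psd K /\ forall p q, G p q = u p + u q - K p q.
Proof.
case: hgamma => disp [T [P [Z [Z2 ZE]]]].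
pose W (p : 'I_n * 'I_m) : T -> R := Z p.2 (x p.1).
have GE p q : (G p q)%:E = ((2^-1)%:E * 'V_P[(W p \- W q)%R])%E.
  (* With base point x q.1, the shifted point of the variogram identity is x p.1. *)
  rewrite /G (ZE _ _ _ (x q.1)).
  by have -> : x q.1 + (x p.1 - x q.1) = x p.1 by rewrite addrC subrK.
split=> [p q|]; last by apply: (variogram_decomp (W := W)) => // p q; exact: Z2.
by rewrite -lee_fin GE mule_ge0 ?variance_ge0 // lee_fin invr_ge0.
Qed.

End PseudoCrossVariogram.

Theorem theorem7p2 (R : realType) (d m : nat) (hd : (0 < d)%N) (hm : (0 < m)%N)
  (gamma : 'rV[R]_d -> 'M[R]_m) (hgamma : pseudo_cross_variogram gamma)
  (f : R[i] -> R[i]) (f_entire : entire f)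
  (f_real : forall x : R, complex.Im (f x%:C) = 0)
  (f0_gt0 : 0 < f 0) (df0 : derive1 (f : R[i] -> R[i]^o) 0 = 0)
  (f_zeros : forall z : R[i], f z = 0 -> complex.Re z = 0)
  (f_order : (growth_order f < 2%:E)%E)
  (nu : R) (hnu : 0 <= nu <= 1) :
  infinitely_divisible (fun h : 'rV[R]_d => \matrix_(i < m, j < m)
    complex.Re (f (nu * Num.sqrt (gamma h i j))%:C / f (Num.sqrt (gamma h i j))%:C)).
Proof.
have fe := entire_centire f_entire.
have df := derive1_cdiff f_entire df0.
have fs := growth_order_subquadratic fe f_order.
pose ff x := complex.Re (f x%:C).
have ff0 x : 0 <= x -> 0 < ff x by exact: restrict_gt0.
(* The symmetry is read off the covariance decomposition for the two points [h] and 0. *)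
have symm h i j : gamma h i j = gamma (- h) j i.
  pose x (k : 'I_2) : 'rV[R]_d := if k == ord0 then h else 0.
  have [_ [u [K [[Ks _] GE]]]] := variogram_kernelP hgamma x.
  have := GE (ord0, i) (lift ord0 ord0, j); have := GE (lift ord0 ord0, j) (ord0, i).
  by rewrite /variogram_kernel /x /= subr0 sub0r => -> ->; rewrite Ks; ring.
pose L h i j := ln (ff (nu * Num.sqrt (gamma h i j))) - ln (ff (Num.sqrt (gamma h i j))).
(* The componentwise r-th power of the target, which is [C 1]; its k-th root is [C k%:R^-1]. *)
pose C r : 'rV[R]_d -> 'M[R]_m := fun h => \matrix_(i, j) expR (r * L h i j).
have CE (h : 'rV[R]_d) i j :
    complex.Re (f (nu * Num.sqrt (gamma h i j))%:C / f (Num.sqrt (gamma h i j))%:C) =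
    expR (L h i j).
  have s0 : 0 <= Num.sqrt (gamma h i j) by [].
  have s1 : 0 <= nu * Num.sqrt (gamma h i j) by rewrite mulr_ge0 //; case/andP: hnu.
  rewrite (restrictE f_real (nu * _)) (restrictE f_real (Num.sqrt _)) -(fmorphV (real_complex R)) -rmorphM /= -/(ff _) -/(ff _).
  by rewrite /L expRB !lnK ?posrE ?ff0.
have CP r : 0 <= r -> positive_definite (C r).
  move=> r0; split=> [h i j|k x a]; first by rewrite !mxE /L symm.
  have [G0 [u [K [Kp GE]]]] := variogram_kernelP hgamma x.
  have Gp t (t0 : 0 <= t) := psd_exp_variogram Kp GE t0.
  have [_ /(_ (fun p => a p.1 p.2 ord0))] :=
    cpd_ln_restrict fe f_real f0_gt0 df f_zeros fs hnu G0 Gp r0.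
  congr (0 <= _).
  (* The scalar form over pairs is regrouped into blocks, one matrix product for each pair of
     points. *)
  rewrite -(pair_bigA _ (fun i p2 => \sum_q a i p2 ord0 *
     expR (r * L (x i - x q.1) p2 q.2) * a q.1 q.2 ord0)) /=.
  apply: eq_bigr => i _.
  under eq_bigr => p2 _ do rewrite -(pair_bigA _ (fun j q2 => a i p2 ord0 *
     expR (r * L (x i - x j) p2 q2) * a j q2 ord0)) /=.
  rewrite exchange_big /=; apply: eq_bigr => j _.
  rewrite !mxE exchange_big /=; apply: eq_bigr => q2 _.
  rewrite !mxE mulr_suml; apply: eq_bigr => p2 _.
  by rewrite !mxE.
have C1E : C 1 = (fun h : 'rV[R]_d => \matrix_(i < m, j < m)
    complex.Re (f (nu * Num.sqrt (gamma h i j))%:C / f (Num.sqrt (gamma h i j))%:C)).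
  by apply: funext => h; apply/matrixP => i j; rewrite !mxE CE mul1r.
rewrite -C1E; split; first exact: CP.
move=> k k0; exists (C k%:R^-1); split; first by apply: CP; rewrite invr_ge0.
move=> h i j; rewrite !mxE -expRM_natl; congr expR.
by rewrite mulrA divff ?pnatr_eq0 -?lt0n.
Qed.
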